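(* Let $m\ge2$, $G=G(m,1,2)<\mathrm{GL}_2(\mathbb{C})<\mathrm{Sp}_4(\mathbb{C})$, $V=\mathbb{C}^4$, $X=\mathbb{C}^2$. Then $\mathsf{HP}_0(\mathcal{O}_V^G,\mathcal{O}_V)\cong\mathrm{gr}\,\mathsf{HH}_0(\mathcal{D}_X^G,\mathcal{D}_X)$, and a homogeneous basis for the former is given by the images of the elements (all exponents being nonnegative integers) $$x_1^ax_2^by_1^ay_2^b\quad(a,b\le m-2);\qquad x_1^{m-1}x_2^ay_1^{m-1}y_2^a+x_1^ax_2^{m-1}y_1^ay_2^{m-1}\quad(1\le a\le m-1);$$ $$x_1^{a+b}y_1^ay_2^b,\quad x_2^{a+b}y_1^by_2^a\qquad(a+b\le m-2,\ b\ge1);$$ $$b\,x_1^{m-1}y_1^{m-1-b}y_2^b-(m-b)\,x_2^{m-1}y_1^{m-b}y_2^{b-1}\qquad(1\le b\le m-1).$$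
   Context: $G(m,1,2)$ is the group of $2\times2$ monomial matrices whose nonzero entries are $m$-th roots of unity. $V=X\oplus X^*$, and $\mathrm{GL}(X)<\mathrm{Sp}(V)$ via $A\mapsto A\oplus(A^{-1})^*$. $\mathcal{O}_V=\mathbb{C}[x_1,x_2,y_1,y_2]$ is graded by polynomial degree, with $\{x_i,y_j\}=\delta_{ij}$, $\{x_i,x_j\}=\{y_i,y_j\}=0$, where $x_1,x_2$ are the standard coordinates on $X$ and $y_1,y_2$ the dual coordinates on $X^*$. $\mathsf{HP}_0(\mathcal{O}_V^G,\mathcal{O}_V):=\mathcal{O}_V/\{\mathcal{O}_V^G,\mathcal{O}_V\}$ (quotient by the linear span of brackets). $\mathcal{D}_X$ is the algebra of polynomial differential operators on $X$, with the additive (Bernstein) filtration in which linear coordinates and their derivations both have degree $1$, so $\mathrm{gr}\,\mathcal{D}_X=\mathcal{O}_V$. $\mathsf{HH}_0(\mathcal{D}_X^G,\mathcal{D}_X):=\mathcal{D}_X/[\mathcal{D}_X^G,\mathcal{D}_X]$ with the induced filtration. There is a canonical graded surjection $\mathsf{HP}_0(\mathcal{O}_V^G,\mathcal{O}_V)\twoheadrightarrow\mathrm{gr}\,\mathsf{HH}_0(\mathcal{D}_X^G,\mathcal{D}_X)$; ''$\cong$'' means that it is an isomorphism. *)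

(* Defs.v *)
From HB Require Import structures.
From mathcomp Require Import all_boot all_order all_algebra.
From mathcomp Require Import generic_quotient complex reals.
From mathcomp Require Import boolp classical_sets functions.
From mathcomp Require Import mpoly.

Set Implicit Arguments.
Unset Strict Implicit.
Unset Printing Implicit Defensive.

Import GRing.Theory.

Local Open Scope ring_scope.
Local Open Scope quotient_scope.

Section Linear.
Variable K : fieldType.

Definition linspan (V : lmodType K) (A : set V) : {pred V} := fun v =>
  `[< exists s : seq (K * V), (forall x, x \in s -> A x.2) /\
        v = \sum_(x <- s) x.1 *: x.2 >].

Lemma linspan_submod_closed (V : lmodType K) (A : set V) :
  submod_closed (linspan A).
Proof.
split=> [|a u v /asboolP[s [sA ->]] /asboolP[t [tA ->]]]; apply/asboolP.
  by exists [::]; split=> //; rewrite big_nil.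
exists ([seq (a * x.1, x.2) | x <- s] ++ t); split=> [x|].
  by rewrite mem_cat => /orP[/mapP[y ys ->]|/tA //]; apply: sA ys.
rewrite big_cat big_map scaler_sumr /=; congr (_ + _).
by apply: eq_bigr => x _; rewrite scalerA.
Qed.
HB.instance Definition _ (V : lmodType K) (A : set V) :=
  GRing.isSubmodClosed.Build K V (linspan A) (linspan_submod_closed A).

Definition lin_preim (U V : lmodType K) (f : {linear U -> V})
  (S : submodClosed V) : {pred U} := fun u => f u \in S.

Lemma lin_preim_submod_closed (U V : lmodType K) (f : {linear U -> V})
  (S : submodClosed V) : submod_closed (lin_preim f S).
Proof.
have [S0 SD] := submodClosedP S.
split=> [|a u v]; rewrite !unfold_in ?linear0 //.
by rewrite linearP; apply: SD.
Qed.
HB.instance Definition _ (U V : lmodType K) (f : {linear U -> V})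
  (S : submodClosed V) :=
  GRing.isSubmodClosed.Build K U (lin_preim f S)
    (lin_preim_submod_closed f S).

Definition lin_image (U V : lmodType K) (f : {linear U -> V})
  (S : submodClosed U) : {pred V} := fun v =>
  `[< exists2 u, u \in S & f u = v >].

Lemma lin_image_submod_closed (U V : lmodType K) (f : {linear U -> V})
  (S : submodClosed U) : submod_closed (lin_image f S).
Proof.
have [S0 SD] := submodClosedP S.
split=> [|a u v /asboolP[x xS <-] /asboolP[y yS <-]]; apply/asboolP.
  by exists 0; rewrite ?linear0.
by exists (a *: x + y); rewrite ?linearP //; apply: SD.
Qed.
HB.instance Definition _ (U V : lmodType K) (f : {linear U -> V})
  (S : submodClosed U) :=
  GRing.isSubmodClosed.Build K V (lin_image f S)
    (lin_image_submod_closed f S).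

Section Submod.
Variables (V : lmodType K) (S : submodClosed V).

Record submod := Submod { submod_val : V; _ : submod_val \in S }.

HB.instance Definition _ := [isSub for submod_val].
HB.instance Definition _ := [Choice of submod by <:].
HB.instance Definition _ := [SubChoice_isSubLmodule of submod by <:].

Definition submod_incl : {linear submod -> V} := \val.

End Submod.

Section Quotient.
Variables (V : lmodType K) (S : submodClosed V).

(* [Quotient.quot] asks for closure under subtraction, which [submodClosed]
   does not provide by inheritance. *)
Definition zmod_pred : {pred V} := fun v => v \in S.

Lemma zmod_pred_closed : zmod_closed zmod_pred.
Proof. exact: GRing.submod_closedB (submodClosedP S). Qed.
HB.instance Definition _ :=
  GRing.isZmodClosed.Build V zmod_pred zmod_pred_closed.

Definition quotmod := Quotient.quot zmod_pred.

HB.instance Definition _ := GRing.Zmodule.on quotmod.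

Definition quot_scale (a : K) (x : quotmod) : quotmod :=
  \pi_(Quotient.quot zmod_pred) (a *: repr x).

Definition quot_pi (v : V) : quotmod := \pi_(Quotient.quot zmod_pred) v.

Lemma quot_piP u v : (quot_pi u = quot_pi v) <-> (u - v \in S).
Proof.
have E := @Quotient.idealrBE _ zmod_pred u v.
split=> [/eqP|] uv; first by move: uv; rewrite -E.
by apply/eqP; rewrite -E.
Qed.

Lemma quot_pi_surj (x : quotmod) : exists v, x = quot_pi v.
Proof. by exists (repr x); rewrite /quot_pi reprK. Qed.

Lemma quot_scaleE a v : quot_scale a (quot_pi v) = quot_pi (a *: v).
Proof.
apply/quot_piP; rewrite -scalerBr.
have [S0 SD] := submodClosedP S.
rewrite -[X in X \in _]addr0; apply: SD => //.
by apply/quot_piP; rewrite /quot_pi reprK.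
Qed.

Lemma quot_piB : zmod_morphism quot_pi.
Proof. exact: (raddfB \pi_(Quotient.quot zmod_pred)). Qed.
HB.instance Definition _ := GRing.isZmodMorphism.Build V quotmod quot_pi quot_piB.

Lemma quot_scaleA a b x : quot_scale a (quot_scale b x) = quot_scale (a * b) x.
Proof. by have [v ->] := quot_pi_surj x; rewrite !quot_scaleE scalerA. Qed.
Lemma quot_scale1 : left_id 1 quot_scale.
Proof. by move=> x; have [v ->] := quot_pi_surj x; rewrite !quot_scaleE scale1r. Qed.
Lemma quot_scaleDr : right_distributive quot_scale +%R.
Proof.
move=> a x y; have [u ->] := quot_pi_surj x; have [v ->] := quot_pi_surj y.
by rewrite -raddfD !quot_scaleE scalerDr raddfD.
Qed.
Lemma quot_scaleDl x : {morph quot_scale^~ x : a b / a + b}.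
Proof.
by move=> a b; have [v ->] := quot_pi_surj x; rewrite !quot_scaleE scalerDl raddfD.
Qed.
HB.instance Definition _ := GRing.Zmodule_isLmodule.Build K quotmod
  quot_scaleA quot_scale1 quot_scaleDr quot_scaleDl.

Lemma quot_pi_scalable : scalable quot_pi.
Proof. by move=> a v; rewrite -quot_scaleE. Qed.
HB.instance Definition _ :=
  GRing.isScalable.Build K V quotmod _ quot_pi quot_pi_scalable.

End Quotient.

Section DirectSum.
Variable M : nat -> lmodType K.

Definition dprod := forall d, M d.

HB.instance Definition _ := gen_eqMixin dprod.
HB.instance Definition _ := gen_choiceMixin dprod.

Definition dprod_zero : dprod := fun=> 0.
Definition dprod_opp (u : dprod) : dprod := fun d => - u d.
Definition dprod_add (u v : dprod) : dprod := fun d => u d + v d.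
Definition dprod_scale (a : K) (u : dprod) : dprod := fun d => a *: u d.

Fact dprod_addA : associative dprod_add.
Proof. by move=> u v w; apply: functional_extensionality_dep => d; exact: addrA. Qed.
Fact dprod_addC : commutative dprod_add.
Proof. by move=> u v; apply: functional_extensionality_dep => d; exact: addrC. Qed.
Fact dprod_add0 : left_id dprod_zero dprod_add.
Proof. by move=> u; apply: functional_extensionality_dep => d; exact: add0r. Qed.
Fact dprod_addN : left_inverse dprod_zero dprod_opp dprod_add.
Proof. by move=> u; apply: functional_extensionality_dep => d; exact: addNr. Qed.
HB.instance Definition _ :=
  GRing.isZmodule.Build dprod dprod_addA dprod_addC dprod_add0 dprod_addN.

Fact dprod_scaleA a b u : dprod_scale a (dprod_scale b u) = dprod_scale (a * b) u.
Proof. by apply: functional_extensionality_dep => d; exact: scalerA. Qed.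
Fact dprod_scale1 : left_id 1 dprod_scale.
Proof. by move=> u; apply: functional_extensionality_dep => d; exact: scale1r. Qed.
Fact dprod_scaleDr : right_distributive dprod_scale +%R.
Proof. by move=> a u v; apply: functional_extensionality_dep => d; exact: scalerDr. Qed.
Fact dprod_scaleDl u : {morph dprod_scale^~ u : a b / a + b}.
Proof. by move=> a b; apply: functional_extensionality_dep => d; exact: scalerDl. Qed.
HB.instance Definition _ := GRing.Zmodule_isLmodule.Build K dprod
  dprod_scaleA dprod_scale1 dprod_scaleDr dprod_scaleDl.

Definition finsupp : {pred dprod} := fun u =>
  `[< exists N : nat, forall d, (N <= d)%N -> u d = 0 >].

Lemma finsupp_submod_closed : submod_closed finsupp.
Proof.
split=> [|a u v /asboolP[N uN] /asboolP[N' vN]]; apply/asboolP.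
  by exists 0%N.
exists (maxn N N') => d; rewrite geq_max => /andP[dN dN'].
rewrite -[LHS]/(a *: u d + v d).
by rewrite uN // vN // scaler0 addr0.
Qed.
HB.instance Definition _ :=
  GRing.isSubmodClosed.Build K dprod finsupp finsupp_submod_closed.

Definition dsum := submod finsupp.

Definition dcomp (d : nat) (u : dsum) : M d := submod_val u d.

End DirectSum.

(* Filtrations are indexed with a shift: [F d] is the space of elements of
   filtration degree < d, so that [F 0] plays the role of F_{-1}. *)
Definition gr_comp (V : lmodType K) (F : nat -> submodClosed V) (d : nat)
  : lmodType K := quotmod (lin_preim (submod_incl (F d.+1)) (F d)).

Definition gr (V : lmodType K) (F : nat -> submodClosed V) : lmodType K :=
  dsum (gr_comp F).

Definition is_basis (V : lmodType K) (s : seq V) : Prop :=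
  forall v : V, exists! c : {ffun 'I_(size s) -> K},
    v = \sum_i c i *: s`_i.

End Linear.

Section HP0_HH0.
Variables (K : fieldType) (n : nat).

(* (g . f)(v) = f(g^{-1} v), v being a column vector. *)
Definition fun_act (k : nat) (g : 'M[K]_k) (f : {mpoly K[k]}) : {mpoly K[k]} :=
  f \mPo [tuple \sum_(j < k) invmx g i j *: 'X_j | i < k].

Local Notation OX := {mpoly K[n]}.

(* The first n variables are the coordinates on X, the last n ones the dual
   coordinates on X^*. *)
Local Notation OV := {mpoly K[n + n]}.

(* The block (invmx A)^T is the matrix of (A^{-1})^* in the dual basis. *)
Definition sp_embed (A : 'M[K]_n) : 'M[K]_(n + n) :=
  block_mx A 0 0 (invmx A)^T.

Definition bracket (f g : OV) : OV :=
  \sum_(i < n) (f^`M(lshift n i) * g^`M(rshift n i)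
                - f^`M(rshift n i) * g^`M(lshift n i)).

Inductive weyl_gen := Mul of 'I_n | Der of 'I_n.

Definition gen_op (t : weyl_gen) : OX -> OX :=
  match t with
  | Mul i => fun p => 'X_i * p
  | Der i => fun p => p^`M(i)
  end.

Definition word_op (w : seq weyl_gen) : OX -> OX :=
  foldr (fun t D => gen_op t \o D) id w.

(* The subalgebra of End(O_X) generated by the x_i and the \partial_i. *)
Definition weyl_pred : submodClosed (OX -> OX) :=
  linspan (range word_op).

Definition DX : lmodType K := submod weyl_pred.

(* Operators of Bernstein degree < d. *)
Definition bernstein_op (d : nat) : submodClosed (OX -> OX) :=
  linspan (word_op @` [set w | (size w < d)%N]).

Definition bernstein (d : nat) : submodClosed DX :=
  lin_preim (submod_incl weyl_pred) (bernstein_op d).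

(* x^a y^b |-> x^a \partial^b, extended linearly. *)
Definition normal_op (f : OV) : OX -> OX := fun p =>
  \sum_(k <- msupp f) f@_k *:
    ('X_[[multinom k (lshift n i) | i < n]] *
     p^`M[[multinom k (rshift n i) | i < n]]).

(* f is the class of D in gr_d D_X = (OV)_d, y_j being identified with the
   class of \partial_j.  For the commutator bracket this gives
   {y_i, x_j} = \delta_ij, the opposite of [bracket]: the sign does not affect
   the linear span of the brackets. *)
Definition is_symbol (d : nat) (D : DX) (f : OV) : Prop :=
  f \is d.-homog /\ submod_incl weyl_pred D - normal_op f \in bernstein_op d.

Variable G : set 'M[K]_n.

Definition OV_inv : set OV :=
  [set f | forall A, G A -> fun_act (sp_embed A) f = f].

Definition HP_brackets : submodClosed OV :=
  linspan [set h | exists f g, OV_inv f /\ h = bracket f g].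

Definition HP0 : lmodType K := quotmod HP_brackets.

Definition HP0_pi : {linear OV -> HP0} := @quot_pi _ _ HP_brackets.

Definition HP0_homog (d : nat) (u : HP0) : Prop :=
  exists2 f : OV, f \is d.-homog & HP0_pi f = u.

Definition DX_inv : set DX :=
  [set D | forall A, G A ->
    fun_act A \o submod_incl weyl_pred D \o fun_act (invmx A) =
    submod_incl weyl_pred D].

Definition HH_commutators : submodClosed DX :=
  linspan [set C : DX | exists E D : DX, DX_inv E /\
    submod_incl weyl_pred C =
      (submod_incl weyl_pred E \o submod_incl weyl_pred D)
      - (submod_incl weyl_pred D \o submod_incl weyl_pred E)].

Definition HH0 : lmodType K := quotmod HH_commutators.

Definition HH0_pi : {linear DX -> HH0} := @quot_pi _ _ HH_commutators.

Definition HH0_filt (d : nat) : submodClosed HH0 :=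
  lin_image HH0_pi (bernstein d).

Definition HH0_gr_pi (d : nat)
  : {linear submod (HH0_filt d.+1) -> gr_comp HH0_filt d} :=
  @quot_pi _ _ (lin_preim (submod_incl (HH0_filt d.+1)) (HH0_filt d)).

(* This determines phi: the class of f, homogeneous of degree d, goes to the
   class in gr_d HH_0 of any D in D_X with symbol f. *)
Definition is_canonical (phi : HP0 -> gr HH0_filt) : Prop :=
  forall (d : nat) (f : OV) (D : DX) (u : submod (HH0_filt d.+1)),
    is_symbol d D f -> submod_incl (HH0_filt d.+1) u = HH0_pi D ->
    dcomp d (phi (HP0_pi f)) = HH0_gr_pi d u /\
    forall e, e <> d -> dcomp e (phi (HP0_pi f)) = 0.

Definition HP0_iso_gr_HH0 : Prop :=
  exists phi : {linear HP0 -> gr HH0_filt}, is_canonical phi /\ bijective phi.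

End HP0_HH0.

Definition monomial_mx (K : fieldType) (n : nat) (A : 'M[K]_n) : Prop :=
  (forall i, exists! j, A i j != 0) /\ (forall j, exists! i, A i j != 0).

Definition G_m1 (K : fieldType) (m n : nat) : set 'M[K]_n :=
  [set A | monomial_mx A /\ forall i j, A i j != 0 -> A i j ^+ m = 1].

Arguments G_m1 : clear implicits.

Section Basis.
Variables (K : fieldType) (m : nat).

Definition x1 : {mpoly K[2 + 2]} := 'X_(lshift 2 0).
Definition x2 : {mpoly K[2 + 2]} := 'X_(lshift 2 1).
Definition y1 : {mpoly K[2 + 2]} := 'X_(rshift 2 0).
Definition y2 : {mpoly K[2 + 2]} := 'X_(rshift 2 1).

Definition basis1 : seq {mpoly K[2 + 2]} :=
  [seq x1 ^+ a * x2 ^+ b * y1 ^+ a * y2 ^+ b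
     | a <- index_iota 0 (m - 1), b <- index_iota 0 (m - 1)].

Definition basis2 : seq {mpoly K[2 + 2]} :=
  [seq x1 ^+ (m - 1) * x2 ^+ a * y1 ^+ (m - 1) * y2 ^+ a
       + x1 ^+ a * x2 ^+ (m - 1) * y1 ^+ a * y2 ^+ (m - 1)
     | a <- index_iota 1 m].

Definition basis3 : seq {mpoly K[2 + 2]} :=
  [seq x1 ^+ (a + b) * y1 ^+ a * y2 ^+ b
     | a <- index_iota 0 (m - 1), b <- index_iota 1 (m - 1 - a)]
  ++ [seq x2 ^+ (a + b) * y1 ^+ b * y2 ^+ a
     | a <- index_iota 0 (m - 1), b <- index_iota 1 (m - 1 - a)].

Definition basis4 : seq {mpoly K[2 + 2]} :=
  [seq b%:R *: (x1 ^+ (m - 1) * y1 ^+ (m - 1 - b) * y2 ^+ b)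
       - (m - b)%:R *: (x2 ^+ (m - 1) * y1 ^+ (m - b) * y2 ^+ (b - 1))
     | b <- index_iota 1 m].

Definition HP0_basis : seq {mpoly K[2 + 2]} := basis1 ++ basis2 ++ basis3 ++ basis4.

End Basis.

Arguments HP0_basis : clear implicits.

(* Main.v *)
(* Normal ordering identifies [O_V] with [D_X] as a filtered space, is
   equivariant under GL(X), and turns commutators into Poisson brackets up to
   lower order.  This gives the canonical graded surjection from HP_0 to gr HH_0.

   Upper bound.  Brackets of monomials with the invariants [x1 y1 + x2 y2],
   [(x1 y1)^2 + (x2 y2)^2], [x1^m + x2^m] and [y1^m + y2^m] already reduce every
   monomial to the listed elements, of which there are (m - 1)(2m - 1).

   Lower bound.  Each element [A] of [G] such that [A - 1] is invertible yields an
   [A]-twisted trace on [D_X], which vanishes on the commutators with invariant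
   operators.  There are (m - 1)(2m - 1) such elements, and their traces are
   linearly independent, being Gaussian with pairwise distinct covariances
   [(A - 1)^-1].  Hence the operators lifting the listed elements form a basis of
   HH_0 adapted to the filtration, which forces both assertions. *)
From HB Require Import structures.
Require Import Defs.
From mathcomp Require Import all_boot all_order all_algebra.
From mathcomp Require Import cyclic separable cyclotomic.
From mathcomp Require Import complex reals.
From mathcomp Require Import boolp classical_sets functions.
From mathcomp Require Import ring lra zify.
From mathcomp Require Import ssrcomplements mpoly.

Set Implicit Arguments.
Unset Strict Implicit.
Unset Printing Implicit Defensive.

Import Order.TTheory GRing.Theory Num.Theory.

Local Open Scope ring_scope.

(** * Multivariate polynomials *)

(** The product of two normally ordered operators is never expanded. Four rules, for a variable or a
    derivation composed with [normal_op f] on either side, are enough; every other fact about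
    products follows by induction on monomials.

    The covariance is forced: the twisted trace property for the generators $x_i$ and $\partial_i$
    amounts to $AM=M+1=MA$. The trace itself is algebraic, a finite exponential of a
    constant-coefficient operator evaluated at the origin, so no convergence question arises.

    The delicate point is that spanning by $N$ elements and having $N$ independent traces must give
    injectivity on the graded side, not only a dimension of HH_0. The square matrix of trace values
    is invertible, so the lifts are independent in HH_0. Moreover an operator of degree below $d$
    reduces to lifts of degree below $d$ alone. A relation in $\mathrm{gr}_d$ can therefore be
    completed by terms of smaller degree into a relation in HH_0, which must be trivial. *)

Section MpolyComplements.
Variables (n : nat) (K : fieldType).
Implicit Types (f g p : {mpoly K[n]}).

Lemma mnm_ind (P : 'X_{1..n} -> Prop) :
  P 0%MM -> (forall i m, P m -> P (U_(i) + m)%MM) -> forall m, P m.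
Proof.
move=> P0 PS m; move: {2}(mdeg m) (erefl (mdeg m)) => d.
elim: d m => [|d IHd] m dm; first by have /eqP := dm; rewrite mdeg_eq0 => /eqP ->.
have /existsP[i mi] : [exists i, m i != 0%N].
  apply: contra_eqT dm; rewrite negb_exists mdegE => /forallP mi0.
  by rewrite big1 // => i _; have := mi0 i; rewrite negbK => /eqP.
have /submK <- : (U_(i) <= m)%MM by rewrite lep1mP.
rewrite addmC; apply/PS/IHd.
have /submK/(congr1 (@mdeg _)) : (U_(i) <= m)%MM by rewrite lep1mP.
by rewrite mdegD mdeg1 dm addn1 => -[].
Qed.

Lemma mpoly_linear_ind (P : {mpoly K[n]} -> Prop) :
  (forall m, P 'X_[m]) -> (forall a f g, P f -> P g -> P (a *: f + g)) ->
  forall f, P f.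
Proof.
move=> PX PD; have P0 : P 0.
  by have := PD (-1) _ _ (PX 0%MM) (PX 0%MM); rewrite scaleN1r addNr.
by elim/mpolyind => // c m p _ _ Pp; apply: PD.
Qed.

Lemma mpoly_mulX_ind (P : {mpoly K[n]} -> Prop) :
  P 1 -> (forall i f, P f -> P ('X_i * f)) ->
  (forall a f g, P f -> P g -> P (a *: f + g)) ->
  forall f, P f.
Proof.
move=> P1 PX; apply: mpoly_linear_ind => m.
elim/mnm_ind: m => [|i m Pm]; first by rewrite mpolyX0.
by rewrite mpolyXD; apply: PX.
Qed.

Lemma mderivXU i j : ('X_j : {mpoly K[n]})^`M(i) = (i == j)%:R.
Proof.
rewrite mderivX mnm1E eq_sym; case: eqP => [->|_]; last by rewrite scale0r.
rewrite scale1r (_ : (U_(j) - U_(j))%MM = 0%MM) ?mpolyX0 //.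
by apply/mnmP => k; rewrite mnmBE subnn mnm0E.
Qed.

Lemma mderiv1 i : (1 : {mpoly K[n]})^`M(i) = 0.
Proof. by rewrite -mpolyC1 mderivC. Qed.

Lemma mderiv_mulX i j f :
  ('X_j * f)^`M(i) = (i == j)%:R * f + 'X_j * f^`M(i).
Proof. by rewrite mderivM mderivXU. Qed.

Lemma mderiv_expn i f k : (f ^+ k)^`M(i) = k%:R *: (f ^+ k.-1 * f^`M(i)).
Proof.
case: k => [|k]; first by rewrite expr0 mderiv1 scale0r.
elim: k => [|k IHk]; first by rewrite expr1 expr0 mul1r scale1r.
rewrite exprS mderivM IHk -scalerAr mulrA -exprS.
by rewrite -[k.+2%:R]nat1r scalerDl scale1r mulrC.
Qed.

Lemma msize_leP f d :
  reflect (forall m, (d <= mdeg m)%N -> f@_m = 0) (msize f <= d)%N.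
Proof.
apply: (iffP idP) => [fd m dm|fd].
  apply/eqP; rewrite mcoeff_eq0; apply: (@mmeasure_mnm_ge _ _ mdeg).
  exact: leq_trans dm.
rewrite mmeasureE; apply/bigmax_leqP_seq => m mf _.
by rewrite ltnNge; apply: contraL mf => /fd/eqP; rewrite mcoeff_eq0.
Qed.

End MpolyComplements.

(** * Normal ordering in the Weyl algebra *)

Section NormalOrdering.
Variables (K : fieldType) (n : nat).
Local Notation OX := {mpoly K[n]}.
Local Notation OV := {mpoly K[n + n]}.
Implicit Types (f g h : OV) (p q : OX) (i j : 'I_n).
Local Notation N := (@normal_op K n).
Local Notation xv := (fun i => 'X_(lshift n i) : OV).
Local Notation yv := (fun i => 'X_(rshift n i) : OV).
Local Notation dx i f := (mderiv (lshift n i) f).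
Local Notation dy i f := (mderiv (rshift n i) f).

Lemma normal_op_is_linear : linear N.
Proof.
move=> a f g; apply: funext => p /=.
rewrite -[RHS]/(a *: N f p + N g p) /normal_op.
pose F k : OX := 'X_[[multinom k (lshift n i) | i < n]] *
     p^`M[[multinom k (rshift n i) | i < n]].
(* The range of summation depends on the polynomial, so the sums for [f], [g] and their combination
   are first extended to one common finite set of exponents. *)
have E u w : (msize u <= w)%N ->
    \sum_(k <- msupp u) u@_k *: F k = \sum_(k : bmultinom (n + n) w) u@_k *: F k.
  move=> uw; rewrite (big_mksub (bmultinom (n + n) w)) ?msupp_uniq //=; first last.
    by move=> x /msize_mdeg_lt /leq_trans; apply.
  rewrite big_rmcond //= => k /memN_msupp_eq0 ->.
  by rewrite scale0r.
pose w := maxn (msize (a *: f + g)) (maxn (msize f) (msize g)).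
rewrite -/(F) !(E _ w) /w ?leq_max ?leqnn ?orbT //.
rewrite scaler_sumr -big_split /=; apply: eq_bigr => k _.
by rewrite mcoeffD mcoeffZ scalerDl scalerA.
Qed.
HB.instance Definition _ :=
  GRing.isLinear.Build K OV (OX -> OX) *:%R N normal_op_is_linear.

Lemma normal_opDE a f g p : N (a *: f + g) p = a *: N f p + N g p.
Proof. by rewrite linearP. Qed.

Lemma normal_opD f g p : N (f + g) p = N f p + N g p.
Proof. by rewrite [N (f + g)]linearD. Qed.

Lemma normal_opZ a f p : N (a *: f) p = a *: N f p.
Proof. by rewrite [N (a *: f)]linearZ. Qed.

Lemma normal_op0 p : N 0 p = 0.
Proof. by rewrite [N 0]linear0. Qed.

Lemma normal_op_sum (I : Type) (s : seq I) (F : I -> OV) p :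
  N (\sum_(t <- s) F t) p = \sum_(t <- s) N (F t) p.
Proof. by rewrite [N (\sum_(t <- s) _)]linear_sum fct_sumE. Qed.

Lemma normal_op_op_is_linear f : linear (N f).
Proof.
move=> a p q; rewrite /normal_op scaler_sumr -big_split /=.
apply: eq_bigr => k _.
rewrite linearP mulrDr scalerDr -scalerAr !scalerA; congr (_ *: _ + _).
exact: mulrC.
Qed.

Lemma normal_op_opD f p q : N f (p + q) = N f p + N f q.
Proof. by have := normal_op_op_is_linear f 1 p q; rewrite !scale1r. Qed.

Lemma normal_op_op0 f : N f 0 = 0.
Proof. by apply: (@addrI _ (N f 0)); rewrite -normal_op_opD !addr0. Qed.

Lemma normal_op_opZ f a p : N f (a *: p) = a *: N f p.
Proof. by rewrite -[a *: p]addr0 normal_op_op_is_linear normal_op_op0 !addr0. Qed.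

Lemma normal_op_op_sum f (I : Type) (s : seq I) (F : I -> OX) :
  N f (\sum_(t <- s) F t) = \sum_(t <- s) N f (F t).
Proof. exact: (big_morph _ (normal_op_opD f) (normal_op_op0 f)). Qed.

Lemma normal_opX k p :
  N 'X_[k] p = 'X_[[multinom k (lshift n i) | i < n]] *
     p^`M[[multinom k (rshift n i) | i < n]].
Proof. by rewrite /normal_op msuppX big_seq1 mcoeffX eqxx scale1r. Qed.

Lemma normal_op1 p : N 1 p = p.
Proof.
rewrite -mpolyX0 normal_opX.
rewrite (_ : [multinom _ | i < n] = 0%MM); last by apply/mnmP=> i; rewrite mnmE !mnm0E.
rewrite (_ : [multinom _ | i < n] = 0%MM); last by apply/mnmP=> i; rewrite mnmE !mnm0E.
by rewrite mpolyX0 mul1r mderivm0m.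
Qed.

Lemma normal_op_xl i f p : N (xv i * f) p = 'X_i * N f p.
Proof.
elim/mpoly_linear_ind: f => [k|a f g IHf IHg]; last first.
  by rewrite mulrDr -scalerAr !normal_opDE IHf IHg mulrDr -scalerAr.
rewrite -mpolyXD !normal_opX mulrA -mpolyXD; congr ('X_[_] * p^`M[_]).
  by apply/mnmP=> j; rewrite mnmDE !mnmE eq_lshift.
by apply/mnmP=> j; rewrite !mnmE eq_lrshift.
Qed.

Lemma normal_op_yr i f p : N (yv i * f) p = N f p^`M(i).
Proof.
elim/mpoly_linear_ind: f => [k|a f g IHf IHg]; last first.
  by rewrite mulrDr -scalerAr !normal_opDE IHf IHg.
rewrite -mpolyXD !normal_opX -mderivmU1m -mderivmDm; congr ('X_[_] * p^`M[_]).
  by apply/mnmP=> j; rewrite !mnmE eq_rlshift.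
by apply/mnmP=> j; rewrite mnmDE !mnmE eq_rshift.
Qed.

Lemma var_split_ind (P : 'I_(n + n) -> Prop) :
  (forall i, P (lshift n i)) -> (forall i, P (rshift n i)) -> forall k, P k.
Proof. by move=> Pl Pr k; case: (split_ordP k) => i ->. Qed.

(** Moving ['X_i] to the left through the derivations costs one contraction, by the Leibniz rule; on
    symbols this is the derivative in the dual variable. The next rule is the mirror image, a
    derivation being moved to the right through the coefficients. *)
Lemma normal_op_xr i f p : N f ('X_i * p) = 'X_i * N f p + N (dy i f) p.
Proof.
elim/mpoly_mulX_ind: f p => [p|k f IHf p|a f g IHf IHg p].
- by rewrite !normal_op1 mderiv1 raddf0 addr0.
- elim/var_split_ind: k => j; rewrite mderiv_mulX.
    rewrite normal_op_xl IHf eq_rlshift mul0r add0r !normal_op_xl; ring.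
  rewrite normal_opD !normal_op_yr mderiv_mulX normal_op_opD IHf eq_rshift (eq_sym j).
  case: eqP => _; rewrite ?mul0r ?mul1r ?normal_op_op0 ?normal_op0; ring.
- rewrite [mderiv _ (_ + _)]linearP /= !normal_opDE IHf IHg mulrDr -scalerAr scalerDr.
  by rewrite addrACA.
Qed.

Lemma normal_op_dl i f p : (N f p)^`M(i) = N (yv i * f + dx i f) p.
Proof.
rewrite normal_opD.
elim/mpoly_mulX_ind: f p => [p|k f IHf p|a f g IHf IHg p].
- by rewrite normal_op_yr !normal_op1 mderiv1 raddf0 addr0.
- elim/var_split_ind: k => j; rewrite mderiv_mulX.
    rewrite normal_opD mulrCA !normal_op_xl mderiv_mulX IHf normal_op_yr.
    rewrite eq_lshift mulrDr addrCA; congr (_ + _); congr (_ + _).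
    by case: eqP => _; rewrite ?mul0r ?mul1r ?normal_op0.
  by rewrite eq_lrshift mul0r add0r mulrCA !normal_op_yr IHf !normal_op_yr.
- rewrite mulrDr -scalerAr !normal_opDE [mderiv _ (_ + _)]linearP /= IHf IHg.
  rewrite [mderiv _ (_ + _)]linearP /= !normal_opDE scalerDr; exact: addrACA.
Qed.

End NormalOrdering.

Section LinSpan.
Variables (K : fieldType) (V : lmodType K) (A : set V).

Lemma linspan_gen v : A v -> v \in linspan A.
Proof.
move=> Av; apply/asboolP; exists [:: (1, v)]; split=> [x|].
  by rewrite inE => /eqP ->.
by rewrite big_seq1 scale1r.
Qed.

Lemma linspan_ind (P : V -> Prop) :
  P 0 -> (forall v, A v -> P v) -> (forall a u v, P u -> P v -> P (a *: u + v)) ->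
  forall v, v \in linspan A -> P v.
Proof.
move=> P0 PA PD v /asboolP[s [sA ->]].
elim: s sA => [|x s IHs] sA; first by rewrite big_nil.
rewrite big_cons; apply: PD; first by apply/PA/sA; rewrite mem_head.
by apply: IHs => y ys; apply: sA; rewrite inE ys orbT.
Qed.
End LinSpan.

(** * Degree estimates for polynomials *)

Section DegreeBound.
Variables (K : fieldType) (n : nat).
Implicit Types (f g : {mpoly K[n]}).

(* [deg f < d - c], stated without truncated subtraction. *)
Definition deg_lt (c d : nat) f := forall k, f@_k != 0 -> (mdeg k + c < d)%N.

Lemma deg_lt_msize f d : (msize f <= d)%N <-> deg_lt 0 d f.
Proof.
split=> [/msize_leP fd k|fd].
  by rewrite addn0 ltnNge; apply: contra => /fd ->.
apply/msize_leP => k dk; apply/eqP; apply: contraTT dk => /fd.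
by rewrite addn0 ltnNge.
Qed.

Lemma deg_lt_le c d c' d' f :
  deg_lt c d f -> (d + c' <= d' + c)%N -> deg_lt c' d' f.
Proof. by move=> fd le k /fd; lia. Qed.

Lemma deg_lt0 c d : deg_lt c d 0.
Proof. by move=> k; rewrite mcoeff0 eqxx. Qed.

Lemma deg_ltD c d a f g :
  deg_lt c d f -> deg_lt c d g -> deg_lt c d (a *: f + g).
Proof.
move=> fd gd k; rewrite mcoeffD mcoeffZ => kfg.
have [fk|/fd//] := eqVneq f@_k 0; apply: gd.
by apply: contra kfg => /eqP ->; rewrite fk mulr0 addr0.
Qed.

Lemma deg_ltX m : deg_lt 0 (mdeg m).+1 ('X_[m] : {mpoly K[n]}).
Proof.
by move=> k; rewrite mcoeffX addn0; case: (m =P k) => [->|]; rewrite ?eqxx.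
Qed.

Lemma deg_lt_mulX c d m f :
  deg_lt c d f -> deg_lt c (mdeg m + d) ('X_[m] * f).
Proof.
move=> fd k; rewrite mulrC -mcoeff_msupp (perm_mem (msuppMX _ _)).
by case/mapP => k'; rewrite mcoeff_msupp => /fd ? ->; rewrite mdegD; lia.
Qed.

Lemma deg_lt_deriv c d i f : deg_lt c d f -> deg_lt c.+1 d f^`M(i).
Proof.
move=> fd k; rewrite mcoeff_deriv => fk.
have /fd : f@_(k + U_(i)) != 0 by apply: contra fk => /eqP ->; rewrite mul0rn.
by rewrite mdegD mdeg1; lia.
Qed.

End DegreeBound.

(** * The Poisson bracket as a biderivation *)

Section Bracket.
Variables (K : fieldType) (n : nat).
Local Notation OV := {mpoly K[n + n]}.
Implicit Types (f g h : OV) (i : 'I_n).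

Lemma bracket_linearl h : linear (fun f : OV => bracket f h).
Proof.
move=> a f g; rewrite /bracket scaler_sumr -big_split; apply: eq_bigr => i _ /=.
rewrite !linearP !mulrDl scalerBr -!scalerAl opprD; exact: addrACA.
Qed.

Lemma bracket_linearr f : linear (bracket f).
Proof.
move=> a g h; rewrite /bracket scaler_sumr -big_split; apply: eq_bigr => i _ /=.
rewrite !linearP !mulrDr scalerBr -!scalerAr opprD; exact: addrACA.
Qed.
HB.instance Definition _ f :=
  GRing.isLinear.Build K OV OV *:%R (bracket f) (bracket_linearr f).

Lemma bracketDl f g h : bracket (f + g) h = bracket f h + bracket g h.
Proof. by have := bracket_linearl h 1 f g; rewrite !scale1r. Qed.

Lemma bracket0l h : bracket 0 h = 0.
Proof. by apply: (@addrI _ (bracket 0 h)); rewrite -bracketDl !addr0. Qed.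

Lemma bracket_suml (I : Type) (s : seq I) (F : I -> OV) h :
  bracket (\sum_(i <- s) F i) h = \sum_(i <- s) bracket (F i) h.
Proof.
elim: s => [|i s IHs]; first by rewrite !big_nil bracket0l.
by rewrite !big_cons bracketDl IHs.
Qed.

Lemma bracketMl f g h : bracket (f * g) h = f * bracket g h + bracket f h * g.
Proof.
rewrite /bracket mulr_sumr mulr_suml -big_split; apply: eq_bigr => i _ /=.
rewrite !mderivM; ring.
Qed.

Lemma bracketXl i h : bracket 'X_(lshift n i) h = h^`M(rshift n i).
Proof.
rewrite /bracket (bigD1 i) //= big1 => [|j ji]; rewrite !mderivXU.
  by rewrite eqxx eq_rlshift mul1r mul0r subr0 addr0.
by rewrite eq_rlshift eq_lshift (negPf ji) !mul0r subr0.
Qed.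

Lemma bracketYl i h : bracket 'X_(rshift n i) h = - h^`M(lshift n i).
Proof.
rewrite /bracket (bigD1 i) //= big1 => [|j ji]; rewrite !mderivXU.
  by rewrite eqxx eq_lrshift mul1r mul0r sub0r addr0.
by rewrite eq_lrshift eq_rshift (negPf ji) !mul0r subr0.
Qed.

Lemma bracket1l h : bracket 1 h = 0.
Proof.
by rewrite /bracket big1 // => i _; rewrite !mderiv1 !mul0r subrr.
Qed.

Lemma bracket_expn f h k :
  bracket (f ^+ k) h = k%:R *: (f ^+ k.-1 * bracket f h).
Proof.
case: k => [|k]; first by rewrite expr0 bracket1l scale0r.
elim: k => [|k IHk]; first by rewrite expr1 expr0 mul1r scale1r.
rewrite exprS bracketMl IHk -scalerAr mulrA -exprS.
by rewrite -[k.+2%:R]natr1 scalerDl scale1r (mulrC (bracket f h)).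
Qed.

End Bracket.

(** * Products and commutators up to lower order; the Bernstein filtration *)

Section Filtration.
Variables (K : fieldType) (n : nat).
Local Notation OX := {mpoly K[n]}.
Local Notation OV := {mpoly K[n + n]}.
Implicit Types (f g h : OV) (i j : 'I_n) (E : OX -> OX).
Local Notation N := (@normal_op K n).
Local Notation xv := (fun i => 'X_(lshift n i) : OV).
Local Notation yv := (fun i => 'X_(rshift n i) : OV).

Definition op_deg_lt c d E := exists2 f, deg_lt c d f & E = N f.

Lemma op_deg_lt_le c d c' d' E :
  op_deg_lt c d E -> (d + c' <= d' + c)%N -> op_deg_lt c' d' E.
Proof. by case=> f fd -> le; exists f => //; apply: deg_lt_le le. Qed.

Lemma op_deg_lt0 c d : op_deg_lt c d 0.
Proof. by exists 0; [exact: deg_lt0|rewrite linear0]. Qed.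

Lemma op_deg_ltD c d a E E' :
  op_deg_lt c d E -> op_deg_lt c d E' -> op_deg_lt c d (a *: E + E').
Proof.
case=> f fd -> [g gd ->]; exists (a *: f + g); first exact: deg_ltD.
by rewrite normal_op_is_linear.
Qed.

Lemma op_deg_lt_sum c d (I : eqType) (s : seq I) (a : I -> K) (F : I -> OX -> OX) :
  (forall t, t \in s -> op_deg_lt c d (F t)) ->
  op_deg_lt c d (\sum_(t <- s) a t *: F t).
Proof.
elim: s => [|t s IHs] Fd; first by rewrite big_nil; exact: op_deg_lt0.
rewrite big_cons; apply: op_deg_ltD; first by apply: Fd; rewrite mem_head.
by apply: IHs => u us; apply: Fd; rewrite inE us orbT.
Qed.

Lemma op_deg_lt_xl c d i E :
  op_deg_lt c d E -> op_deg_lt c d.+1 (fun p => 'X_i * E p).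
Proof.
case=> f fd ->; exists (xv i * f).
  by have := @deg_lt_mulX _ _ _ _ U_(lshift n i) _ fd; rewrite mdeg1.
by apply: funext => p; rewrite normal_op_xl.
Qed.

Lemma op_deg_lt_yr c d i E :
  op_deg_lt c d E -> op_deg_lt c d.+1 (fun p => E p^`M(i)).
Proof.
case=> f fd ->; exists (yv i * f).
  by have := @deg_lt_mulX _ _ _ _ U_(rshift n i) _ fd; rewrite mdeg1.
by apply: funext => p; rewrite normal_op_yr.
Qed.

(** The product of symbols is the part without contraction. Each contraction of a derivation on the
    left with a coefficient on the right lowers the degree by 2, whence the shift [c.+2]. *)
Lemma normal_op_prodX c q m h : deg_lt c q h ->
  op_deg_lt c.+2 (mdeg m + q) (N 'X_[m] \o N h - N ('X_[m] * h)).
Proof.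
elim/mnm_ind: m c q h => [|k m IHm] c q h hq.
  rewrite (_ : _ - _ = 0); first exact: op_deg_lt0.
  by apply: funext => p; apply/eqP; rewrite subr_eq0 /= mpolyX0 normal_op1 mul1r.
rewrite mdegD mdeg1 add1n addSn mpolyXD.
elim/var_split_ind: k => i.
  rewrite (_ : _ - _ = fun p => 'X_i * (N 'X_[m] \o N h - N ('X_[m] * h)) p).
    exact/op_deg_lt_xl/IHm.
  apply: funext => p; rewrite -mulrA.
  rewrite -[LHS]/(N _ (N _ p) - N _ p) -[RHS]/('X_i * (N _ (N _ p) - N _ p)).
  by rewrite !normal_op_xl mulrBr.
set hx := h^`M(lshift n i).
have hxq : deg_lt c.+1 q hx by apply: deg_lt_deriv.
(* The variable [yv i] is a derivation acting just before [N 'X_[m]]. Pushed into [N h], it yields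
   [yv i * h], handled by induction, and the contracted symbol [hx], whose whole product belongs to
   the remainder. *)
have -> : N (yv i * 'X_[m]) \o N h - N (yv i * 'X_[m] * h) =
   1 *: (N 'X_[m] \o N (yv i * h) - N ('X_[m] * (yv i * h))) +
   (1 *: (N 'X_[m] \o N hx - N ('X_[m] * hx)) + N ('X_[m] * hx)).
  rewrite !scale1r subrK; apply: funext => p.
  rewrite -[LHS]/(N _ (N _ p) - N _ p) -[RHS]/(N _ (N _ p) - N _ p + N _ (N _ p)).
  rewrite normal_op_yr normal_op_dl normal_opD normal_op_opD addrAC mulrCA mulrA.
  by [].
apply: op_deg_ltD.
  rewrite -addnS; apply: IHm.
  by have := @deg_lt_mulX _ _ _ _ U_(rshift n i) _ hq; rewrite mdeg1.
apply: op_deg_ltD; first by apply: op_deg_lt_le (IHm _ _ _ hxq) _; lia.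
exists ('X_[m] * hx) => //.
by apply: (deg_lt_le (deg_lt_mulX hxq)); lia.
Qed.

(** The shift is 3 rather than 2 because both bounds [p] and [q] are strict and their sum gains one
    more unit. *)
Lemma normal_op_prod b c p q f h : deg_lt b p f -> deg_lt c q h ->
  op_deg_lt (b + c).+3 (p + q) (N f \o N h - N (f * h)).
Proof.
move=> fp hq.
have -> : N f \o N h - N (f * h) =
   \sum_(k <- msupp f) f@_k *: (N 'X_[k] \o N h - N ('X_[k] * h)).
  apply: funext => r; rewrite fct_sumE -[LHS]/(N f (N h r) - N (f * h) r).
  rewrite {1 2}[f]mpolyE mulr_suml !normal_op_sum -sumrB.
  by apply: eq_bigr => k _; rewrite -scalerAl !normal_opZ -scalerBr.
apply: op_deg_lt_sum => k; rewrite mcoeff_msupp => /fp kp.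
by apply: op_deg_lt_le (normal_op_prodX k hq) _; lia.
Qed.

(* Modulo lower order both sides are derivations in ['X_[m]], so it suffices to
   compare them on the variables. *)
Lemma normal_op_commX q m h : deg_lt 0 q h ->
  op_deg_lt 3 (mdeg m + q)
    (N 'X_[m] \o N h - (N h \o N 'X_[m]) + N (bracket 'X_[m] h)).
Proof.
elim/mnm_ind: m => [|k m IHm] hq.
  rewrite (_ : _ + _ = 0); first exact: op_deg_lt0.
  apply: funext => p; rewrite -[LHS]/(N _ (N _ p) - N _ (N _ p) + N _ p).
  by rewrite mpolyX0 bracket1l normal_op0 !normal_op1 subrr addr0.
have {}IHm := IHm hq.
rewrite mdegD mdeg1 add1n addSn mpolyXD bracketMl.
elim/var_split_ind: k => i.
  rewrite bracketXl; set hy := h^`M(rshift n i).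
  have -> : N (xv i * 'X_[m]) \o N h - (N h \o N (xv i * 'X_[m])) +
      N (xv i * bracket 'X_[m] h + hy * 'X_[m]) =
      1 *: (fun p => 'X_i * (N 'X_[m] \o N h - (N h \o N 'X_[m]) + N (bracket 'X_[m] h)) p)
      + (-1 *: (N hy \o N 'X_[m] - N (hy * 'X_[m])) + 0).
    apply: funext => p.
    rewrite scale1r addr0 scaleN1r.
    rewrite -[LHS]/(N _ (N _ p) - N _ (N _ p) + N _ p).
    rewrite -[RHS]/('X_i * (N _ (N _ p) - N _ (N _ p) + N _ p) - (N _ (N _ p) - N _ p)).
    rewrite normal_opD !normal_op_xl normal_op_xr -/hy; ring.
  apply: op_deg_ltD; first exact: op_deg_lt_xl.
  apply: op_deg_ltD; last exact: op_deg_lt0.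
  have hyq : deg_lt 1 q hy by apply: deg_lt_deriv.
  apply: op_deg_lt_le (normal_op_prod hyq (@deg_ltX K _ m)) _; lia.
rewrite bracketYl; set hx := h^`M(lshift n i).
have -> : N (yv i * 'X_[m]) \o N h - (N h \o N (yv i * 'X_[m])) +
      N (yv i * bracket 'X_[m] h + - hx * 'X_[m]) =
      1 *: (fun p => (N 'X_[m] \o N h - (N h \o N 'X_[m]) + N (bracket 'X_[m] h)) p^`M(i))
      + (1 *: (N 'X_[m] \o N hx - N ('X_[m] * hx)) + 0).
  apply: funext => p.
  rewrite addr0 !scale1r.
  rewrite -[LHS]/(N _ (N _ p) - N _ (N _ p) + N _ p).
  rewrite -[RHS]/((N _ (N _ _) - N _ (N _ _) + N _ _) + (N _ (N _ p) - N _ p)).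
  rewrite !normal_op_yr normal_op_dl -/hx normal_opD normal_op_yr normal_op_opD.
  rewrite normal_opD normal_op_yr mulNr (linearN N) /= [_ * hx]mulrC.
  rewrite -[(- N _) p]/(- N _ p); ring.
apply: op_deg_ltD; first exact: op_deg_lt_yr.
apply: op_deg_ltD; last exact: op_deg_lt0.
have hxq : deg_lt 1 q hx by apply: deg_lt_deriv.
apply: op_deg_lt_le (normal_op_prod (@deg_ltX K _ m) hxq) _; lia.
Qed.

(** The plus sign reflects $[\partial_i,x_i]=1$ against $\{y_i,x_i\}=-1$. As [q] is a strict bound,
    the bracket has degree at most $d+q-3$, and the shift 3 places the remainder strictly below
    it. *)
Lemma normal_op_comm d q f h : f \is d.-homog -> deg_lt 0 q h ->
  op_deg_lt 3 (d + q) (N f \o N h - (N h \o N f) + N (bracket f h)).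
Proof.
move=> /dhomogP fd hq.
have -> : N f \o N h - (N h \o N f) + N (bracket f h) =
   \sum_(k <- msupp f) f@_k *:
     (N 'X_[k] \o N h - (N h \o N 'X_[k]) + N (bracket 'X_[k] h)).
  apply: funext => r.
  rewrite -[LHS]/(N f (N h r) - N h (N f r) + N (bracket f h) r).
  rewrite fct_sumE {1 2 3}[f]mpolyE bracket_suml !normal_op_sum normal_op_op_sum.
  rewrite -sumrB -big_split; apply: eq_bigr => k _ /=.
  have -> : bracket (f@_k *: 'X_[k]) h = f@_k *: bracket 'X_[k] h.
    by have := bracket_linearl h f@_k 'X_[k] 0; rewrite bracket0l !addr0.
  by rewrite !normal_opZ normal_op_opZ -scalerBr -scalerDr.
apply: op_deg_lt_sum => k /fd /= <-; exact: normal_op_commX.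
Qed.

Lemma normal_op_word w : exists2 f, deg_lt 0 (size w).+1 f & word_op w = N f.
Proof.
elim: w => [|t w [f fw IHw]] /=.
  exists 1; last by apply: funext => p; rewrite normal_op1.
  by move=> k; rewrite mcoeff1; case: (k =P 0%MM) => [->|]; rewrite ?mdeg0 ?eqxx.
rewrite IHw; case: t => i /=.
  exists (xv i * f); last by apply: funext => p; rewrite normal_op_xl.
  by have := @deg_lt_mulX _ _ _ _ U_(lshift n i) _ fw; rewrite mdeg1.
exists (1 *: (yv i * f) + f^`M(lshift n i)).
  apply: deg_ltD.
    by have := @deg_lt_mulX _ _ _ _ U_(rshift n i) _ fw; rewrite mdeg1.
  by apply: (deg_lt_le (deg_lt_deriv fw)); lia.
by apply: funext => p; rewrite scale1r /= normal_op_dl.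
Qed.

Lemma word_op_cat (u v : seq (weyl_gen n)) p :
  word_op (u ++ v) p = word_op u (word_op v p) :> OX.
Proof. by elim: u => [|t u IHu] //=; rewrite IHu. Qed.

Lemma normal_opX_word m :
  exists2 w, size w = mdeg m & N 'X_[m] = word_op w.
Proof.
elim/mnm_ind: m => [|k m [w wm IHm]].
  by exists [::]; [rewrite mdeg0|apply: funext => p; rewrite mpolyX0 normal_op1].
rewrite mdegD mdeg1 -wm mpolyXD; elim/var_split_ind: k => i.
  exists (Mul i :: w) => //; apply: funext => p.
  by rewrite normal_op_xl IHm.
exists (w ++ [:: Der i]); first by rewrite size_cat addn1.
by apply: funext => p; rewrite normal_op_yr IHm word_op_cat.
Qed.

(** Straightening a word never raises the degree, and a monomial symbol is itself a word of length
    its degree. From here on the filtration is read on polynomials. *)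
Lemma bernstein_opP d E :
  reflect (exists2 f, (msize f <= d)%N & E = N f) (E \in bernstein_op K n d).
Proof.
apply: (iffP idP) => [|[f fd ->]].
  elim/linspan_ind => [|_ [w wd <-]|a u v [f fd ->] [g gd ->]].
  - by exists 0; rewrite ?msize0 ?linear0.
  - have [f fw ->] := normal_op_word w; exists f => //.
    by apply/deg_lt_msize; apply: deg_lt_le fw _; move: wd => /=; lia.
  - exists (a *: f + g); last by rewrite normal_op_is_linear.
    by apply/deg_lt_msize/deg_ltD; apply/deg_lt_msize.
rewrite [f]mpolyE linear_sum /= big_seq rpred_sum // => k kf.
rewrite linearZ /= rpredZ //.
have [w wk ->] := normal_opX_word k; apply: linspan_gen; exists w => //=.
by rewrite wk; apply: leq_trans (msize_mdeg_lt kf) fd.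
Qed.

Lemma weyl_predP E : reflect (exists f, E = N f) (E \in weyl_pred K n).
Proof.
apply: (iffP idP) => [|[f ->]].
  elim/linspan_ind => [|_ [w wd <-]|a u v [f ->] [g ->]].
  - by exists 0; rewrite linear0.
  - by have [f fw ->] := normal_op_word w; exists f.
  - by exists (a *: f + g); exact/esym/normal_op_is_linear.
rewrite [f]mpolyE linear_sum /= rpred_sum // => k _.
rewrite linearZ /= rpredZ //.
by have [w wk ->] := normal_opX_word k; apply: linspan_gen; exists w.
Qed.

(** Commutators of [N f] with the generators are, up to sign, the operators of the partial
    derivatives of [f]. Hence the kernel is stable under derivation, and in characteristic 0 the
    coefficients of positive degree are recovered from those of the derivatives. *)
Lemma normal_op_inj (charK : [pchar K] =i pred0) : injective N.
Proof.
suff N0 d : forall f, N f = 0 -> forall k, mdeg k = d -> f@_k = 0.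
  move=> f g fg; apply/eqP; rewrite -subr_eq0; apply/eqP/mpolyP => k.
  by rewrite mcoeff0; apply: (N0 (mdeg k)); rewrite // linearB /= fg subrr.
elim: d => [|d IHd] f f0 k.
  move=> /eqP; rewrite mdeg_eq0 => /eqP ->.
  (* Applied to 1 and evaluated at the origin, the operator retains only the constant coefficient:
     derivations kill 1 and variables vanish at the origin. *)
  have /(congr1 (mcoeff 0%MM)) : N f 1 = 0 by rewrite f0.
  rewrite mcoeff0.
  rewrite {1}[f]mpolyE normal_op_sum linear_sum /= => f0_.
  rewrite -[RHS]f0_; apply/esym.
  have E k' : (N (f@_k' *: 'X_[k']) 1)@_0 = f@_k' * (k' == 0%MM)%:R.
    rewrite normal_opZ mcoeffZ; congr (_ * _); elim/mnm_ind: k' => [|i m IHm].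
      by rewrite mpolyX0 normal_op1 mcoeff1 !eqxx.
    rewrite mpolyXD mnmD_eq0 mnm1_eq0; elim/var_split_ind: i => i.
      rewrite normal_op_xl (mcoeff0_is_multiplicative n K).1.
      by rewrite mcoeffX mnm1_eq0 mul0r.
    by rewrite normal_op_yr mderiv1 normal_op_op0 mcoeff0.
  under eq_bigr do rewrite E.
  have [f00|f00] := eqVneq f@_0 0.
    by rewrite f00 big1 // => k' _; case: eqP => [->|]; rewrite ?f00 ?mulr0 ?mul0r.
  rewrite (bigD1_seq 0%MM) ?msupp_uniq ?mcoeff_msupp //= eqxx mulr1.
  by rewrite big1 ?addr0 // => k' /negPf ->; rewrite mulr0.
move=> kd.
have f0E p : N f p = 0 by rewrite f0.
have [i [m -> md]] : exists i : 'I_(n + n), exists2 m, k = (U_(i) + m)%MM & mdeg m = d.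
  elim/mnm_ind: k kd => [|i m _]; first by rewrite mdeg0.
  by rewrite mdegD mdeg1 => -[md]; exists i, m.
have : N f^`M(i) = 0.
  apply: funext => p; elim/var_split_ind: i => i.
    have := normal_op_dl i f p; rewrite normal_opD normal_op_yr !f0E.
    by rewrite linear0 add0r => <-.
  by have := normal_op_xr i f p; rewrite !f0E mulr0 add0r => <-.
move=> /IHd/(_ m md); rewrite mcoeff_deriv addmC -mulr_natr => /eqP.
rewrite mulf_eq0 => /orP[/eqP//|].
by move/pcharf0P: charK => ->.
Qed.

End Filtration.

(** * Equivariance of normal ordering *)

Section FunAct.
Variables (K : fieldType) (n : nat).
Implicit Types (A : 'M[K]_n) (f p q : {mpoly K[n]}).

Lemma fun_actD A : {morph fun_act A : p q / p + q}.
Proof. exact: comp_mpolyD. Qed.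

Lemma fun_actZ A a : {morph fun_act A : p / a *: p}.
Proof. by move=> p; exact: comp_mpolyZ. Qed.

Lemma fun_act0 A : fun_act A 0 = 0.
Proof. exact: comp_mpoly0. Qed.

Lemma fun_act_sum A (I : Type) (r : seq I) (F : I -> {mpoly K[n]}) :
  fun_act A (\sum_(i <- r) F i) = \sum_(i <- r) fun_act A (F i).
Proof. exact: (big_morph _ (fun_actD A) (fun_act0 A)). Qed.

Lemma fun_actM A : {morph fun_act A : p q / p * q}.
Proof. by move=> p q; rewrite /fun_act rmorphM. Qed.

Lemma fun_act1 A : fun_act A 1 = 1.
Proof. exact: comp_mpoly1. Qed.

Lemma fun_actX A i : fun_act A 'X_i = \sum_j invmx A i j *: 'X_j.
Proof. by rewrite /fun_act comp_mpolyXU -tnth_nth tnth_mktuple. Qed.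

Lemma fun_actK A : A \in unitmx -> cancel (fun_act (invmx A)) (fun_act A).
Proof.
move=> uA; elim/mpoly_mulX_ind => [|i f IHf|a f g IHf IHg].
- by rewrite !fun_act1.
- rewrite !fun_actM IHf; congr (_ * _); rewrite fun_actX fun_act_sum invmxK.
  under eq_bigr do rewrite fun_actZ fun_actX scaler_sumr.
  rewrite exchange_big (bigD1 i) //= [X in _ + X]big1 => [|j ji].
    under eq_bigr do rewrite scalerA.
    rewrite addr0 -scaler_suml; have := congr1 (fun B : 'M_n => B i i) (mulmxV uA).
    by rewrite /mulmx !mxE eqxx => ->; rewrite scale1r.
  under eq_bigr do rewrite scalerA.
  rewrite -scaler_suml; have := congr1 (fun B : 'M_n => B i j) (mulmxV uA).
  by rewrite /mulmx !mxE eq_sym (negPf ji) => ->; rewrite scale0r.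
- by rewrite !fun_actD !fun_actZ IHf IHg.
Qed.

Lemma fun_actVK A : A \in unitmx -> cancel (fun_act A) (fun_act (invmx A)).
Proof.
by move=> uA; have := @fun_actK (invmx A); rewrite invmxK unitmx_inv; apply.
Qed.

Lemma mderiv_fun_act A i p :
  (fun_act A p)^`M(i) = \sum_j invmx A j i *: fun_act A p^`M(j).
Proof.
elim/mpoly_mulX_ind: p => [|k f IHf|a f g IHf IHg].
- rewrite fun_act1 mderiv1 big1 // => j _.
  by rewrite mderiv1 fun_act0 scaler0.
- rewrite fun_actM mderivM IHf.
  under [RHS]eq_bigr do rewrite mderiv_mulX fun_actD !fun_actM scalerDr.
  rewrite big_split /=; congr (_ + _); last first.
    by rewrite mulr_sumr; apply: eq_bigr => j _; rewrite scalerAr.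
  rewrite (bigD1 k) //= [X in _ + X]big1 => [|j jk].
    rewrite eqxx fun_act1 mul1r addr0 fun_actX linear_sum /=.
    rewrite (bigD1 i) //= [X in _ + X]big1 => [|j ji].
      by rewrite addr0 linearZ /= mderivXU eqxx -scalerAl mul1r.
    by rewrite linearZ /= mderivXU eq_sym (negPf ji) scaler0.
  by rewrite (negPf jk) fun_act0 mul0r scaler0.
- rewrite fun_actD fun_actZ linearP /= IHf IHg scaler_sumr -big_split.
  apply: eq_bigr => j _ /=; rewrite linearP /= fun_actD fun_actZ scalerDr !scalerA.
  by rewrite mulrC.
Qed.

Lemma fun_act_deriv A i p : A \in unitmx ->
  fun_act A (fun_act (invmx A) p)^`M(i) = \sum_j A j i *: p^`M(j).
Proof.
move=> uA; rewrite mderiv_fun_act fun_act_sum invmxK.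
by apply: eq_bigr => j _; rewrite fun_actZ fun_actK.
Qed.

Lemma fun_act_homog A d f : f \is d.-homog -> fun_act A f \is d.-homog.
Proof.
move=> /dhomogP fd; rewrite [f]mpolyE fun_act_sum big_seq rpred_sum // => m /fd /= <-.
rewrite fun_actZ rpredZ //; elim/mnm_ind: m => [|i m IHm].
  by rewrite mpolyX0 fun_act1 mdeg0 dhomog1.
rewrite mpolyXD fun_actM mdegD; apply: dhomogM => //.
rewrite fun_actX rpred_sum // => j _.
by rewrite rpredZ // dhomogX /= !mdeg1.
Qed.

Lemma pihomog_fun_act A d f :
  pihomog mdeg d (fun_act A f) = fun_act A (pihomog mdeg d f).
Proof.
elim/mpoly_linear_ind: f => [m|a f g IHf IHg].
  have Xm : ('X_[m] : {mpoly K[n]}) \is (mdeg m).-homog by rewrite dhomogX.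
  rewrite pihomogX; case: eqP => [<-|/eqP md].
    by rewrite pihomog_dE ?fun_act_homog.
  by rewrite fun_act0 (pihomog_ne0 md) ?fun_act_homog.
by rewrite fun_actD fun_actZ !linearP /= fun_actD fun_actZ IHf IHg.
Qed.

End FunAct.

Section Equivariance.
Variables (K : fieldType) (n : nat) (A : 'M[K]_n).
Hypothesis uA : A \in unitmx.
Local Notation OX := {mpoly K[n]}.
Local Notation OV := {mpoly K[n + n]}.
Local Notation N := (@normal_op K n).
Local Notation xv := (fun i => 'X_(lshift n i) : OV).
Local Notation yv := (fun i => 'X_(rshift n i) : OV).

Lemma invmx_sp_embed : invmx (sp_embed A) = block_mx (invmx A) 0 0 A^T.
Proof.
have E : sp_embed A *m block_mx (invmx A) 0 0 A^T = 1%:M.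
  rewrite /sp_embed mulmx_block !mulmx0 !mul0mx !addr0 !add0r mulmxV //.
  by rewrite -trmx_mul mulmxV // trmx1 -scalar_mx_block.
have [us _] := mulmx1_unit E.
by rewrite -[RHS]mul1mx -(mulVmx us) -mulmxA E mulmx1.
Qed.

Lemma fun_act_sp_x i :
  fun_act (sp_embed A) (xv i) = \sum_j invmx A i j *: xv j.
Proof.
rewrite fun_actX invmx_sp_embed big_split_ord /= [X in _ + X]big1 => [|j _].
  by rewrite addr0; apply: eq_bigr => j _; rewrite block_mxEul.
by rewrite block_mxEur mxE scale0r.
Qed.

Lemma fun_act_sp_y i :
  fun_act (sp_embed A) (yv i) = \sum_j A j i *: yv j.
Proof.
rewrite fun_actX invmx_sp_embed big_split_ord /= big1 => [|j _].
  by rewrite add0r; apply: eq_bigr => j _; rewrite block_mxEdr mxE.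
by rewrite block_mxEdl mxE scale0r.
Qed.

(** A linear change of coordinates mixes the $x_i$ among themselves and the $\partial_i$ among
    themselves. Conjugation thus preserves normal order, and no contraction appears. *)
Lemma normal_op_fun_act f p :
  N (fun_act (sp_embed A) f) p = fun_act A (N f (fun_act (invmx A) p)).
Proof.
elim/mpoly_mulX_ind: f p => [p|k f IHf p|a f g IHf IHg p].
- by rewrite fun_act1 !normal_op1 fun_actK.
- rewrite fun_actM; elim/var_split_ind: k => i.
    rewrite fun_act_sp_x normal_op_xl fun_actM -IHf fun_actX mulr_suml.
    rewrite mulr_suml normal_op_sum; apply: eq_bigr => j _.
    by rewrite -!scalerAl normal_opZ normal_op_xl.
  rewrite fun_act_sp_y normal_op_yr mulr_suml normal_op_sum.
  rewrite -[in RHS](fun_actVK uA _^`M(i)) fun_act_deriv // -IHf.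
  rewrite normal_op_op_sum; apply: eq_bigr => j _.
  by rewrite -scalerAl normal_opZ normal_op_yr normal_op_opZ.
- by rewrite fun_actD fun_actZ !normal_opDE IHf IHg fun_actD fun_actZ.
Qed.

End Equivariance.

(** * Twisted traces on the Weyl algebra *)

Section IterComm.
Variables (R : nzRingType) (U : lmodType R) (T : {linear U -> U}) (S P : U -> U).
Hypotheses (TS : forall u, T (S u) = S (T u) + P u)
  (TP : forall u, T (P u) = P (T u)).

(** Intended for [T] the operator [mxlap], [S] the multiplication by a variable, and [P] their
    commutator, which has constant coefficients and so commutes with [T]. *)
Lemma iter_comm_deriv k u :
  iter k.+1 T (S u) = S (iter k.+1 T u) + k.+1%:R *: P (iter k T u).
Proof.
elim: k => [|k IHk]; first by rewrite /= TS scale1r.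
rewrite iterS IHk linearD /= TS linearZ /= TP -addrA; congr (_ + _).
by rewrite -[in RHS]nat1r scalerDl scale1r.
Qed.

Lemma iter_comm k u : iter k T (P u) = P (iter k T u).
Proof. by elim: k => [|k IHk] //; rewrite iterS IHk TP. Qed.
End IterComm.

Section TwistedTrace.
Variables (K : numFieldType) (n : nat) (M : 'M[K]_n).
Local Notation OX := {mpoly K[n]}.
Local Notation OV := {mpoly K[n + n]}.
Local Notation N := (@normal_op K n).
Local Notation xv := (fun i => 'X_(lshift n i) : OV).
Local Notation yv := (fun i => 'X_(rshift n i) : OV).
Local Notation dx i f := (mderiv (lshift n i) f).
Local Notation dy i f := (mderiv (rshift n i) f).
Implicit Types (f g h u v : OV) (i j : 'I_n).

(** The exponent of the Gaussian functional. The operators [mxdy i] and [mxdx j] are its commutators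
    with the multiplications by $x_i$ and $y_j$. *)
Definition mxlap f : OV := \sum_i \sum_j M i j *: dx i (dy j f).
Definition mxdy i f : OV := \sum_j M i j *: dy j f.
Definition mxdx j f : OV := \sum_i M i j *: dx i f.

Lemma mxdy_linear i : linear (mxdy i).
Proof.
move=> a f g; rewrite /mxdy scaler_sumr -big_split; apply: eq_bigr => j _ /=.
by rewrite linearP scalerDr !scalerA mulrC.
Qed.
HB.instance Definition _ i := GRing.isLinear.Build K OV OV *:%R (mxdy i) (mxdy_linear i).

Lemma mxdx_linear i : linear (mxdx i).
Proof.
move=> a f g; rewrite /mxdx scaler_sumr -big_split; apply: eq_bigr => j _ /=.
by rewrite linearP scalerDr !scalerA mulrC.
Qed.
HB.instance Definition _ i := GRing.isLinear.Build K OV OV *:%R (mxdx i) (mxdx_linear i).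

Lemma mxlapEx f : mxlap f = \sum_i dx i (mxdy i f).
Proof.
apply: eq_bigr => i _; rewrite linear_sum; apply: eq_bigr => j _.
by rewrite linearZ.
Qed.

Lemma mxlapEy f : mxlap f = \sum_j dy j (mxdx j f).
Proof.
rewrite /mxlap exchange_big; apply: eq_bigr => i _; rewrite linear_sum.
by apply: eq_bigr => j _; rewrite linearZ /= mderiv_comm.
Qed.

Lemma mxlap_linear : linear mxlap.
Proof.
move=> a f g; rewrite !mxlapEx scaler_sumr -big_split; apply: eq_bigr => j _ /=.
by rewrite !linearP.
Qed.
HB.instance Definition _ := GRing.isLinear.Build K OV OV *:%R mxlap mxlap_linear.

Lemma mxlap_x i f : mxlap (xv i * f) = xv i * mxlap f + mxdy i f.
Proof.
rewrite !mxlapEx mulr_sumr (bigD1 i) //= [in RHS](bigD1 i) //= addrAC.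
congr (_ + _); last first.
  apply: eq_bigr => j ji; rewrite /mxdy !linear_sum mulr_sumr /=.
  apply: eq_bigr => k _; rewrite !linearZ /= mderiv_mulX eq_rlshift mul0r add0r.
  by rewrite mderiv_mulX eq_lshift (negPf ji) mul0r add0r scalerAr.
rewrite /mxdy !linear_sum mulr_sumr -big_split /=.
apply: eq_bigr => k _; rewrite !linearZ /= mderiv_mulX eq_rlshift mul0r add0r.
by rewrite mderiv_mulX eqxx mul1r scalerDr addrC scalerAr.
Qed.

Lemma mxlap_y j f : mxlap (yv j * f) = yv j * mxlap f + mxdx j f.
Proof.
rewrite !mxlapEy mulr_sumr (bigD1 j) //= [in RHS](bigD1 j) //= addrAC.
congr (_ + _); last first.
  apply: eq_bigr => i ji; rewrite /mxdx !linear_sum mulr_sumr /=.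
  apply: eq_bigr => k _; rewrite !linearZ /= mderiv_mulX eq_lrshift mul0r add0r.
  by rewrite mderiv_mulX eq_rshift (negPf ji) mul0r add0r scalerAr.
rewrite /mxdx !linear_sum mulr_sumr -big_split /=.
apply: eq_bigr => k _; rewrite !linearZ /= mderiv_mulX eq_lrshift mul0r add0r.
by rewrite mderiv_mulX eqxx mul1r scalerDr addrC scalerAr.
Qed.

Lemma mxlap_mderiv k f : mxlap f^`M(k) = (mxlap f)^`M(k).
Proof.
rewrite /mxlap linear_sum; apply: eq_bigr => i _; rewrite linear_sum.
apply: eq_bigr => j _; rewrite linearZ /=; congr (_ *: _).
by rewrite (mderiv_comm k) (mderiv_comm k).
Qed.

Lemma mxlap_mxdy i f : mxlap (mxdy i f) = mxdy i (mxlap f).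
Proof.
rewrite [mxdy i f]/mxdy linear_sum; apply: eq_bigr => j _.
by rewrite linearZ /= mxlap_mderiv.
Qed.

Lemma mxlap_mxdx i f : mxlap (mxdx i f) = mxdx i (mxlap f).
Proof.
rewrite [mxdx i f]/mxdx linear_sum; apply: eq_bigr => j _.
by rewrite linearZ /= mxlap_mderiv.
Qed.

(* [gauss M] is the value at the origin of [exp mxlap]; it sends the generating
   function [exp (u.x + v.y)] of normally ordered operators to [exp (u M v)].
   For [M = (A - 1)^-1] this is, up to a scalar, the trace twisted by [A]. *)
Definition gauss_trunc w f : K := \sum_(k < w) (k`!%:R)^-1 * (iter k mxlap f)@_0.
Definition gauss f := gauss_trunc (msize f) f.

Lemma deg_lt_sum c d (I : Type) (r : seq I) (F : I -> OV) :
  (forall t, deg_lt c d (F t)) -> deg_lt c d (\sum_(t <- r) F t).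
Proof.
move=> Fd; elim: r => [|t r IHr]; first by rewrite big_nil; exact: deg_lt0.
by rewrite big_cons -[F t]scale1r; apply: deg_ltD.
Qed.

Lemma iter_mxlap_eq0 k f : (msize f <= k)%N -> iter k mxlap f = 0.
Proof.
move=> fk; have [d fd le] : exists2 d, deg_lt 0 d f & (d <= k)%N.
  by exists (msize f) => //; apply/deg_lt_msize.
have {fd} : deg_lt k d (iter k mxlap f).
  elim: k {fk le} => [|k IHk] //=; rewrite /mxlap.
  apply: deg_lt_sum => i; apply: deg_lt_sum => j.
  rewrite -[_ *: _]addr0; apply: deg_ltD; last exact: deg_lt0.
  by apply: (deg_lt_le (deg_lt_deriv (deg_lt_deriv IHk))); lia.
move=> fd; apply/mpolyP => m; rewrite mcoeff0; apply/eqP.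
by apply: contraT => /fd; lia.
Qed.

Lemma gaussE w f : (msize f <= w)%N -> gauss f = gauss_trunc w f.
Proof.
move=> fw; rewrite /gauss /gauss_trunc -(subnK fw) addnC big_split_ord /=.
rewrite [X in _ = _ + X]big1 ?addr0 // => k _.
by rewrite iter_mxlap_eq0 ?leq_addr // mcoeff0 mulr0.
Qed.

Lemma iter_mxlap_linear k : linear (iter k mxlap).
Proof. by elim: k => [|k IHk] a f g //=; rewrite IHk linearP. Qed.

Lemma gauss_linear : linear (gauss : OV -> K^o).
Proof.
move=> a f g; pose w := maxn (msize (a *: f + g)) (maxn (msize f) (msize g)).
rewrite !(gaussE (w := w)) /w ?leq_max ?leqnn ?orbT // scaler_sumr -big_split.
apply: eq_bigr => k _ /=; rewrite iter_mxlap_linear mcoeffD mcoeffZ.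
rewrite -[RHS]/(a * _ + _) mulrDr; congr (_ + _); exact: mulrCA.
Qed.
HB.instance Definition _ := GRing.isLinear.Build K OV K^o *:%R gauss gauss_linear.

Lemma mcoeff0_mulX k f : ('X_k * f)@_0 = 0.
Proof. by rewrite (mcoeff0_is_multiplicative _ _).1 mcoeffX mnm1_eq0 mul0r. Qed.

(** This is Wick's rule. The term keeping the factor ['X_k] vanishes at the origin, and the factor
    $j+1$ produced by the commutator turns $1/(j+1)!$ into $1/j!$. *)
Lemma gauss_mulX k (P : OV -> OV) f :
  (forall u, mxlap ('X_k * u) = 'X_k * mxlap u + P u) ->
  (forall u, mxlap (P u) = P (mxlap u)) ->
  gauss ('X_k * f) = gauss (P f).
Proof.
move=> lapX lapP; pose w := maxn (msize f).+1 (maxn (msize ('X_k * f)) (msize (P f))).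
(* The left truncation has one more term than the right one, since its term of index 0 vanishes. *)
have wX : (msize ('X_k * f) <= w.+1)%N by rewrite /w; lia.
have wP : (msize (P f) <= w)%N by rewrite /w; lia.
rewrite (gaussE wX) (gaussE wP) /gauss_trunc big_ord_recl /= mcoeff0_mulX mulr0 add0r.
apply: eq_bigr => j _.
rewrite /bump /= add1n -iterS (iter_comm_deriv lapX lapP) (iter_comm lapP).
rewrite mcoeffD mcoeff0_mulX add0r mcoeffZ mulrA factS natrM invfM.
by rewrite [_ ^-1 * _ * _%:R]mulrAC mulVf ?mul1r // pnatr_eq0.
Qed.

Lemma gauss_x i f : gauss (xv i * f) = gauss (mxdy i f).
Proof. exact: gauss_mulX (mxlap_x i) (mxlap_mxdy i). Qed.

Lemma gauss_y i f : gauss (yv i * f) = gauss (mxdx i f).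
Proof. exact: gauss_mulX (mxlap_y i) (mxlap_mxdx i). Qed.


End TwistedTrace.

(** * Twisted cyclicity of the Gaussian functional *)

Section TraceProperty.
Variables (K : numFieldType) (n : nat) (A M : 'M[K]_n).
Hypotheses (uA : A \in unitmx) (AM : A *m M = M + 1%:M).
Local Notation OX := {mpoly K[n]}.
Local Notation OV := {mpoly K[n + n]}.
Local Notation N := (@normal_op K n).
Local Notation xv := (fun i => 'X_(lshift n i) : OV).
Local Notation yv := (fun i => 'X_(rshift n i) : OV).
Local Notation dx i f := (mderiv (lshift n i) f).
Local Notation dy i f := (mderiv (rshift n i) f).
Implicit Types (f g h u v : OV) (i j : 'I_n).

Lemma mulmx_cayley : M *m A = M + 1%:M.
Proof.
have E : (A - 1%:M) *m M = 1%:M by rewrite mulmxBl mul1mx AM addrC addKr.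
have := mulmx1C E; rewrite mulmxBr mulmx1 => /eqP.
by rewrite subr_eq addrC => /eqP.
Qed.

(** With $H$ the operator of [h], this is the symbol of $H\circ(Ax_iA^{-1})$; [conj_y] is that of
    $H\circ(A\partial_iA^{-1})$. *)
Definition conj_x i h : OV := \sum_j invmx A i j *: (xv j * h + dy j h).
Definition conj_y i h : OV := \sum_j A j i *: (yv j * h).

Lemma normal_op_conj_x i h p :
  N (conj_x i h) p = N h (fun_act A ('X_i * fun_act (invmx A) p)).
Proof.
rewrite fun_actM fun_actX (fun_actK uA) mulr_suml normal_op_op_sum normal_op_sum.
apply: eq_bigr => j _; rewrite -scalerAl normal_op_opZ normal_opZ.
by rewrite normal_opD normal_op_xl normal_op_xr.
Qed.

Lemma normal_op_conj_y i h p :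
  N (conj_y i h) p = N h (fun_act A (fun_act (invmx A) p)^`M(i)).
Proof.
rewrite (fun_act_deriv _ _ uA) normal_op_op_sum normal_op_sum.
by apply: eq_bigr => j _; rewrite normal_op_opZ normal_opZ normal_op_yr.
Qed.

Lemma gauss_sum (I : Type) (r : seq I) (F : I -> OV) :
  gauss M (\sum_(t <- r) F t) = \sum_(t <- r) gauss M (F t).
Proof. exact: (linear_sum (gauss M : {linear OV -> K^o})). Qed.

Lemma gaussD f g : gauss M (f + g) = gauss M f + gauss M g.
Proof. exact: (linearD (gauss M : {linear OV -> K^o})). Qed.

Lemma gaussZ a f : gauss M (a *: f) = a * gauss M f.
Proof. exact: (linearZ_LR (gauss M : {linear OV -> K^o})). Qed.

(** Twisted cyclicity for the generator $x_i$. By Wick's rule the right side has coefficient matrix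
    $A^{-1}(M+1)=A^{-1}AM=M$, the same as the left side. *)
Lemma gauss_conj_x i h : gauss M (xv i * h) = gauss M (conj_x i h).
Proof.
rewrite /conj_x gauss_sum.
have E j : gauss M (xv j * h + dy j h) = \sum_l (A *m M) j l * gauss M (dy l h).
  rewrite gaussD gauss_x gauss_sum AM [X in _ + X](_ : _ = \sum_l (1%:M : 'M[K]_n) j l * gauss M (dy l h)).
    by rewrite -big_split; apply: eq_bigr => l _; rewrite gaussZ !mxE mulrDl.
  rewrite (bigD1 j) //= big1 => [|l lj]; first by rewrite mxE eqxx mul1r addr0.
  by rewrite mxE eq_sym (negPf lj) mul0r.
under [RHS]eq_bigr do rewrite gaussZ E mulr_sumr.
rewrite exchange_big gauss_x gauss_sum; apply: eq_bigr => l _ /=.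
under [RHS]eq_bigr do rewrite mulrA.
rewrite -mulr_suml gaussZ; congr (_ * _).
by rewrite -{1}[M]mul1mx -(mulVmx uA) -mulmxA [LHS]mxE.
Qed.

(** Twisted cyclicity for $\partial_i$: the left argument is the symbol of $\partial_i\circ H$. The
    matrix identity needed is now $MA=M+1$. *)
Lemma gauss_conj_y i h : gauss M (yv i * h + dx i h) = gauss M (conj_y i h).
Proof.
rewrite /conj_y gauss_sum.
under [RHS]eq_bigr do rewrite gaussZ gauss_y gauss_sum mulr_sumr.
rewrite exchange_big /= gaussD gauss_y gauss_sum.
have -> : gauss M (dx i h) = \sum_l (1%:M : 'M[K]_n) l i * gauss M (dx l h).
  rewrite (bigD1 i) //= big1 => [|l lj]; first by rewrite mxE eqxx mul1r addr0.
  by rewrite mxE (negPf lj) mul0r.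
rewrite -big_split; apply: eq_bigr => l _ /=.
under [RHS]eq_bigr do rewrite gaussZ mulrA (mulrC (A _ _)).
rewrite gaussZ -mulr_suml -mulrDl; congr (_ * _).
by have := congr1 (fun B : 'M_n => B l i) mulmx_cayley; rewrite !mxE => ->.
Qed.

Lemma normal_op_comp f g : exists s, N s = N f \o N g.
Proof.
have [r _ E] := normal_op_prod ((deg_lt_msize f _).1 (leqnn _))
  ((deg_lt_msize g _).1 (leqnn _)).
by exists (r + f * g); rewrite linearD /= -E subrK.
Qed.

(** Products enter only through symbols [u] and [v] that represent them. The left factor is carried
    across one generator at a time, so [h], which absorbs what has been moved, must be general in
    the induction. *)
Lemma gauss_twisted_trace f h u v :
  N u = N f \o N h -> N v = N h \o (fun_act A \o N f \o fun_act (invmx A)) ->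
  gauss M u = gauss M v.
Proof.
have Ninj : injective N by apply/normal_op_inj/pchar_num.
elim/mpoly_mulX_ind: f h u v => [|k f IHf|a f g IHf IHg] h u v Nu Nv.
- congr gauss; apply: Ninj; rewrite Nu Nv; apply: funext => p /=.
  by rewrite !normal_op1 (fun_actK uA).
- elim/var_split_ind: k Nu Nv => i Nu Nv.
    have [s Ns] := normal_op_comp f h.
    have -> : u = xv i * s.
      by apply: Ninj; rewrite Nu; apply: funext => p /=; rewrite !normal_op_xl Ns.
    rewrite gauss_conj_x; apply: (IHf (conj_x i h)).
      by apply: funext => p /=; rewrite !normal_op_conj_x Ns.
    rewrite Nv; apply: funext => p /=.
    by rewrite normal_op_conj_x (fun_actVK uA) normal_op_xl.
  (* Since [yv i] puts the derivation between [N f] and [N h], it is first absorbed into [h]; the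
     induction hypothesis then moves [f] away and leaves the derivation in front, ready for
     [gauss_conj_y]. *)
  have [s Ns] := normal_op_comp h (fun_act (sp_embed A) f).
  transitivity (gauss M (yv i * s + dx i s)).
    apply: (IHf (yv i * h + dx i h)).
      rewrite Nu; apply: funext => p /=.
      by rewrite normal_op_yr normal_op_dl.
    apply: funext => p; rewrite -normal_op_dl Ns /= -normal_op_dl.
    by rewrite (normal_op_fun_act uA).
  rewrite gauss_conj_y; congr gauss; apply: Ninj; rewrite Nv.
  apply: funext => p; rewrite normal_op_conj_y Ns /= (normal_op_fun_act uA).
  by rewrite (fun_actVK uA) normal_op_yr.
- have [u1 Nu1] := normal_op_comp f h; have [u2 Nu2] := normal_op_comp g h.
  have [v1 Nv1] := normal_op_comp h (fun_act (sp_embed A) f).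
  have [v2 Nv2] := normal_op_comp h (fun_act (sp_embed A) g).
  have E1 : gauss M u1 = gauss M v1.
    apply: (IHf h u1 v1 Nu1); rewrite Nv1; apply: funext => p /=.
    by rewrite (normal_op_fun_act uA).
  have E2 : gauss M u2 = gauss M v2.
    apply: (IHg h u2 v2 Nu2); rewrite Nv2; apply: funext => p /=.
    by rewrite (normal_op_fun_act uA).
  have -> : u = a *: u1 + u2.
    apply: Ninj; rewrite [RHS]normal_op_is_linear Nu1 Nu2 Nu; apply: funext => p.
    exact: normal_opDE.
  have -> : v = a *: v1 + v2.
    apply: Ninj; rewrite [RHS]normal_op_is_linear Nv1 Nv2 Nv; apply: funext => p.
    rewrite -[RHS]/(a *: N h (N (fun_act (sp_embed A) f) p) + N h (N (fun_act (sp_embed A) g) p)).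
    rewrite !(normal_op_fun_act uA) /= normal_opDE fun_actD fun_actZ.
    by rewrite normal_op_opD normal_op_opZ.
  by rewrite !gaussD !gaussZ E1 E2.
Qed.

End TraceProperty.

(** * Linear independence of Gaussian functionals *)

Section Independence.
Variable K : numFieldType.

Lemma poly_nonroot (p : {poly K}) : p != 0 -> exists s, ~~ root p s.
Proof.
move=> p0; pose rs : seq K := [seq k%:R | k <- iota 0 (size p)].
have /allPn[s _ ps] : ~~ all (root p) rs.
  apply/negP => rts; have /(max_poly_roots p0 rts) : uniq rs.
    by rewrite map_inj_uniq ?iota_uniq // => i j /eqP; rewrite eqr_nat => /eqP.
  by rewrite size_map size_iota ltnn.
by exists s.
Qed.

(** A Vandermonde argument: the vanishing moments annihilate every polynomial, in particular the one
    whose roots are all the nodes except [lam i]. *)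
Lemma power_sums_independent (I : finType) (lam c : I -> K) : injective lam ->
  (forall k : nat, \sum_i c i * lam i ^+ k = 0) -> forall i, c i = 0.
Proof.
move=> lam_inj c0 i.
have cP (p : {poly K}) : \sum_i c i * p.[lam i] = 0.
  under eq_bigr do rewrite horner_coef mulr_sumr.
  rewrite exchange_big big1 // => k _ /=.
  by under eq_bigr do rewrite mulrCA; rewrite -mulr_sumr c0 mulr0.
have := cP (\prod_(j | j != i) ('X - (lam j)%:P)).
rewrite (bigD1 i) //= [X in _ + X]big1 => [|j ji].
  rewrite addr0 => /eqP; rewrite mulf_eq0 => /orP[/eqP //|].
  rewrite horner_prod prodf_seq_eq0 => /hasP[j _ /andP[ji]].
  by rewrite hornerXsubC subr_eq0 => /eqP/lam_inj/esym/eqP; rewrite (negPf ji).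
by rewrite horner_prod (bigD1 j) //= hornerXsubC subrr mul0r mulr0.
Qed.

(* Kronecker substitution: with [u i = s ^ i] and [v j = s ^ (n * j)] the value
   of the form is a polynomial in [s] whose coefficients are the entries. *)
Lemma separating_bilinear_form (n : nat) (I : finType) (M : I -> 'M[K]_n) :
  injective M -> exists u v : 'I_n -> K,
    injective (fun t => \sum_i \sum_j u i * M t i j * v j).
Proof.
move=> M_inj.
pose P t : {poly K} := \sum_i \sum_j M t i j *: 'X^(i + n * j).
have P_inj t t' : P t = P t' -> t = t'.
  move=> Ptt'; apply: M_inj; apply/matrixP => a b.
  have PE r : (P r)`_(a + n * b) = M r a b.
    rewrite coef_sum (bigD1 a) //= [X in _ + X]big1 => [|i ia].
      rewrite addr0 coef_sum (bigD1 b) //= [X in _ + X]big1 => [|j jb].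
        by rewrite coefZ coefXn eqxx mulr1 addr0.
      rewrite coefZ coefXn eqn_add2l eqn_pmul2l ?(leq_ltn_trans _ (ltn_ord a)) //.
      by rewrite eq_sym -val_eqE in jb; rewrite (negPf jb) mulr0.
    rewrite coef_sum big1 // => j _; rewrite coefZ coefXn.
    case: eqP => [/(congr1 (modn^~ n))|]; last by rewrite mulr0.
    have modE (x : 'I_n) y : ((x + n * y) %% n = x)%N.
      by rewrite addnC mulnC modnMDl modn_small.
    by rewrite /= !modE => /ord_inj ai; rewrite ai eqxx in ia.
  by rewrite -!PE Ptt'.
(* Finitely many nonzero differences have to be kept nonzero at once, hence a single nonroot of
   their product. *)
have [s ns] : exists s, ~~ root (\prod_(t : I * I | t.1 != t.2) (P t.1 - P t.2)) s.
  apply: poly_nonroot; rewrite prodf_seq_neq0; apply/allP => -[t t'] _ /=.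
  by apply/implyP; apply: contra; rewrite subr_eq0 => /eqP/P_inj ->.
exists (fun i => s ^+ i), (fun j => s ^+ (n * j)) => t t'.
have PE r : \sum_(i < n) \sum_(j < n) s ^+ i * M r i j * s ^+ (n * j) = (P r).[s].
  rewrite horner_sum; apply: eq_bigr => i _; rewrite horner_sum.
  by apply: eq_bigr => j _; rewrite hornerZ hornerXn exprD mulrCA mulrA.
rewrite /= !PE => Pt; apply/eqP; apply: contraNT ns => tt'.
rewrite /root horner_prod prodf_seq_eq0; apply/hasP; exists (t, t').
  exact: mem_index_enum.
by rewrite /= tt' hornerD hornerN Pt subrr eqxx.
Qed.

Variable n : nat.
Local Notation OV := {mpoly K[n + n]}.
Local Notation xv := (fun i => 'X_(lshift n i) : OV).
Local Notation yv := (fun i => 'X_(rshift n i) : OV).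
Local Notation dy i f := (mderiv (rshift n i) f).

(** The factor $k!$ counts the pairings of $k$ positions with $k$ momenta. These test polynomials
    turn each functional into the sequence of powers of one number. *)
Lemma gauss_power (M : 'M[K]_n) (u v : 'I_n -> K) k :
  gauss M ((\sum_i u i *: xv i) ^+ k * (\sum_j v j *: yv j) ^+ k) =
  k`!%:R * (\sum_i \sum_j u i * M i j * v j) ^+ k.
Proof.
set al := (X in X ^+ k * _); set be := (X in _ * X ^+ k); set lam := (X in _ = _ * X ^+ k).
have dal j : dy j al = 0.
  rewrite linear_sum big1 // => i _.
  by rewrite linearZ /= mderivXU eq_rlshift scaler0.
have dalk j l : dy j (al ^+ l) = 0.
  by rewrite mderiv_expn dal mulr0 scaler0.
have dbe j : dy j be = (v j)%:MP.
  rewrite linear_sum (bigD1 j) //= big1 => [|i ij].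
    by rewrite linearZ /= mderivXU eqxx addr0 -alg_mpolyC.
  by rewrite linearZ /= mderivXU eq_rshift eq_sym (negPf ij) scaler0.
elim: k => [|k IHk].
  rewrite !expr0 mulr1 mul1r /gauss /gauss_trunc msize1 big_ord1.
  by rewrite /= mcoeff1 eqxx invr1 mulr1.
rewrite [al ^+ k.+1]exprS -mulrA {1}/al mulr_suml gauss_sum.
transitivity (\sum_i \sum_j u i * M i j * (k.+1%:R * v j * gauss M (al ^+ k * be ^+ k))).
  apply: eq_bigr => i _; rewrite -scalerAl gaussZ gauss_x gauss_sum mulr_sumr.
  apply: eq_bigr => j _; rewrite gaussZ mderivM dalk mul0r add0r mderiv_expn dbe.
  rewrite -scalerAr gaussZ [_ * (v j)%:MP]mulrC mul_mpolyC -scalerAr gaussZ.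
  by rewrite !mulrA.
rewrite IHk factS natrM exprS /lam.
have E x : x * \sum_i \sum_j u i * M i j * v j = \sum_i \sum_j u i * M i j * v j * x.
  rewrite mulr_sumr; apply: eq_bigr => i _; rewrite mulr_sumr.
  by apply: eq_bigr => j _; rewrite mulrC.
rewrite mulrA E -/lam mulr_suml; apply: eq_bigr => i _; rewrite mulr_suml.
by apply: eq_bigr => j _; ring.
Qed.

Lemma gauss_independent (I : finType) (M : I -> 'M[K]_n) (c : I -> K) :
  injective M -> (forall f, \sum_i c i * gauss (M i) f = 0) -> forall i, c i = 0.
Proof.
move=> /separating_bilinear_form[u [v lam_inj]] c0.
apply: (power_sums_independent lam_inj) => k.
have := c0 ((\sum_i u i *: xv i) ^+ k * (\sum_j v j *: yv j) ^+ k).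
under eq_bigr do rewrite gauss_power mulrCA.
rewrite -mulr_sumr => /eqP; rewrite mulf_eq0 => /orP[|/eqP //].
by rewrite pnatr_eq0 eqn0Ngt fact_gt0.
Qed.

End Independence.

(** * The canonical map to the associated graded space *)

Section Homogeneous.
Variables (K : fieldType) (n : nat).

Lemma mderiv_homog p i (f : {mpoly K[n]}) :
  f \is p.-homog -> f^`M(i) \is p.-1.-homog.
Proof.
move=> /dhomogP fp; apply/dhomogP => k; rewrite mcoeff_msupp mcoeff_deriv => fk.
have /fp /= : (k + U_(i))%MM \in msupp f.
  by rewrite mcoeff_msupp; apply: contra fk => /eqP ->; rewrite mul0rn.
by rewrite mdegD mdeg1 addn1 => <-.
Qed.

Lemma mderiv_homog0 i (f : {mpoly K[n]}) : f \is 0.-homog -> f^`M(i) = 0.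
Proof.
move=> /dhomogP f0; apply/mpolyP => k; rewrite mcoeff_deriv mcoeff0.
rewrite (_ : f@_(k + U_(i)) = 0) ?mul0rn //; apply: memN_msupp_eq0.
by apply/negP => /f0 /=; rewrite mdegD mdeg1 addn1.
Qed.

Lemma homog_deg_lt p (f : {mpoly K[n]}) : f \is p.-homog -> deg_lt 0 p.+1 f.
Proof.
by move=> /dhomogP fp k; rewrite -mcoeff_msupp => /fp /= ->; rewrite addn0.
Qed.
End Homogeneous.

Lemma bracket_homog (K : fieldType) n p q (f g : {mpoly K[n + n]}) :
  f \is p.-homog -> g \is q.-homog -> bracket f g \is (p + q - 2).-homog.
Proof.
move=> fp gq; rewrite /bracket rpred_sum // => i _.
suff H a b : f^`M(a) * g^`M(b) \is (p + q - 2).-homog by rewrite rpredB.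
case: p fp => [|p] fp; first by rewrite mderiv_homog0 ?mul0r ?dhomog0.
case: q gq => [|q] gq; first by rewrite (mderiv_homog0 _ gq) mulr0 dhomog0.
rewrite (_ : (p.+1 + q.+1 - 2 = p + q)%N); last by lia.
exact: dhomogM (mderiv_homog _ fp) (mderiv_homog _ gq).
Qed.



Section Quot.
Variables (K : fieldType) (V : lmodType K) (S : submodClosed V).

Lemma quot_pi_eq0 v : quot_pi S v = 0 <-> v \in S.
Proof. by rewrite -(linear0 (quot_pi S)) quot_piP subr0. Qed.

End Quot.

Section Canonical.
Variables (K : numFieldType) (n : nat) (G : set 'M[K]_n).
Hypothesis uG : forall A, G A -> A \in unitmx.
Local Notation OX := {mpoly K[n]}.
Local Notation OV := {mpoly K[n + n]}.
Local Notation N := (@normal_op K n).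
Local Notation incl := (submod_incl (weyl_pred K n)).
Implicit Types (f g : OV).

Fact weyl_of_subproof f : N f \in weyl_pred K n.
Proof. by apply/weyl_predP; exists f. Qed.
Definition weyl_of f : DX K n := Submod (weyl_of_subproof f).

Lemma weyl_ofE f : incl (weyl_of f) = N f. Proof. by []. Qed.

Lemma weyl_of_linear : linear weyl_of.
Proof.
by move=> a f g; apply: val_inj; exact: normal_op_is_linear.
Qed.
HB.instance Definition _ :=
  GRing.isLinear.Build K OV (DX K n) *:%R weyl_of weyl_of_linear.

Lemma weyl_of_surj D : exists f, D = weyl_of f.
Proof.
have /weyl_predP[f Df] : incl D \in weyl_pred K n by apply: valP.
by exists f; apply: val_inj.
Qed.

Lemma weyl_of_bernstein d f : (msize f <= d)%N -> weyl_of f \in bernstein K n d.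
Proof. by move=> fd; apply/bernstein_opP; exists f. Qed.

Lemma bernstein_weyl_of d D : D \in bernstein K n d ->
  exists2 f, (msize f <= d)%N & D = weyl_of f.
Proof. by move=> /bernstein_opP[f fd Df]; exists f => //; apply: val_inj. Qed.

Definition HHc f : HH0 G := HH0_pi G (weyl_of f).

Lemma HHc_linear : linear HHc.
Proof. by move=> a f g; rewrite /HHc !linearP. Qed.
HB.instance Definition _ :=
  GRing.isLinear.Build K OV (HH0 G) *:%R HHc HHc_linear.

Lemma HHc_filt d f : (msize f <= d)%N -> HHc f \in HH0_filt G d.
Proof.
by move=> fd; apply/asboolP; exists (weyl_of f) => //; exact: weyl_of_bernstein.
Qed.

Lemma HH0_filtP d x : x \in HH0_filt G d ->
  exists2 f, (msize f <= d)%N & x = HHc f.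
Proof.
by move=> /asboolP[D /bernstein_weyl_of[f fd ->] <-]; exists f.
Qed.

Lemma normal_op_inv f : OV_inv G f -> DX_inv G (weyl_of f).
Proof.
move=> fG A GA; rewrite weyl_ofE; apply: funext => p /=.
by rewrite -(normal_op_fun_act (uG GA)) fG.
Qed.

(** The commutator with an invariant operator vanishes in HH_0 and lifts minus the bracket, so the
    class of the bracket equals that of the remainder. *)
Lemma HHc_bracket p q f g : OV_inv G f -> f \is p.-homog -> g \is q.-homog ->
  HHc (bracket f g) \in HH0_filt G (p + q - 2).
Proof.
move=> fG fp gq.
have [r rd E] := normal_op_comm fp (homog_deg_lt gq).
have -> : HHc (bracket f g) = HHc r.
  apply/eqP; rewrite -subr_eq0 -linearB; apply/eqP/quot_pi_eq0.
  have -> : weyl_of (bracket f g - r) = - 1 *: weyl_of (r - bracket f g).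
    by rewrite -linearZ scaleN1r opprB.
  apply: rpredZ; apply: linspan_gen; exists (weyl_of f), (weyl_of g).
  split; first exact: normal_op_inv.
  by rewrite !weyl_ofE linearB /= -E addrK.
(* The strict bound for [g] is [q.+1], so the remainder has degree below $p+(q+1)-3$. *)
apply: HHc_filt; apply/deg_lt_msize => k /rd; lia.
Qed.

Lemma OV_inv_pihomog d f : OV_inv G f -> OV_inv G (pihomog mdeg d f).
Proof. by move=> fG A GA; rewrite -pihomog_fun_act fG. Qed.

Definition HHp d f : HH0 G := HHc (pihomog mdeg d f).

Lemma HHp_linear d : linear (HHp d).
Proof. by move=> a f g; rewrite /HHp (pihomog_is_linear mdeg d) HHc_linear. Qed.
HB.instance Definition _ d :=
  GRing.isLinear.Build K OV (HH0 G) *:%R (HHp d) (HHp_linear d).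

(** Because the group acts linearly, the homogeneous components of an invariant are invariant; this
    reduces the claim to homogeneous brackets. *)
Lemma HHp_bracket d h : h \in HP_brackets G -> HHp d h \in HH0_filt G d.
Proof.
elim/linspan_ind => [|_ [f [g [fG ->]]]|a u v hu hv]; first by rewrite linear0 rpred0.
  rewrite (@pihomog_partitionE _ _ mdeg (msize f) f) //.
  rewrite (@pihomog_partitionE _ _ mdeg (msize g) g) //.
  rewrite bracket_suml linear_sum rpred_sum // => p _.
  rewrite [bracket _ _]linear_sum linear_sum rpred_sum // => q _ /=.
  have Hb := bracket_homog (pihomogP mdeg p f) (pihomogP mdeg q g).
  have [<-|/eqP ne] := (p + q - 2)%N =P d.
    rewrite /HHp (pihomog_dE Hb); apply: HHc_bracket; [|exact: pihomogP..].
    exact: OV_inv_pihomog.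
  by rewrite /HHp (pihomog_ne0 ne Hb) linear0 rpred0.
by rewrite linearP rpredD ?rpredZ.
Qed.

Lemma msize_pihomog d f : (msize (pihomog mdeg d f) <= d.+1)%N.
Proof. exact/deg_lt_msize/homog_deg_lt/pihomogP. Qed.

Fact hcomp_subproof d f : HHp d f \in HH0_filt G d.+1.
Proof. exact/HHc_filt/msize_pihomog. Qed.
Definition hcomp d f : submod (HH0_filt G d.+1) := Submod (hcomp_subproof d f).

Lemma hcomp_linear d : linear (hcomp d).
Proof.
by move=> a f g; apply: val_inj; exact: HHp_linear.
Qed.

Lemma HH0_gr_pi_eq0 d u :
  HH0_gr_pi G d u = 0 <-> submod_incl (HH0_filt G d.+1) u \in HH0_filt G d.
Proof. exact: quot_pi_eq0. Qed.

Definition psi_dprod f : dprod (gr_comp (HH0_filt G)) :=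
  fun d => HH0_gr_pi G d (hcomp d f).

Lemma pihomog_big d f : (msize f <= d)%N -> pihomog mdeg d f = 0.
Proof.
move=> fd; rewrite pihomogE big_seq_cond big1 // => m /andP[mf /eqP md].
by have := msize_mdeg_lt mf; rewrite ltnNge /= -md in fd *; rewrite fd.
Qed.

Fact psi_subproof f : psi_dprod f \in @finsupp K (gr_comp (HH0_filt G)).
Proof.
apply/asboolP; exists (msize f) => d fd; apply/HH0_gr_pi_eq0.
by rewrite -[submod_incl _ _]/(HHc _) pihomog_big // linear0 rpred0.
Qed.
Definition psi f : gr (HH0_filt G) := Submod (psi_subproof f).

Lemma psi_linear : linear psi.
Proof.
move=> a f g; apply: val_inj; apply: functional_extensionality_dep => d.
rewrite -[RHS]/(a *: HH0_gr_pi G d (hcomp d f) + HH0_gr_pi G d (hcomp d g)) /=.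
by rewrite /psi_dprod hcomp_linear linearP.
Qed.
HB.instance Definition _ :=
  GRing.isLinear.Build K OV (gr (HH0_filt G)) *:%R psi psi_linear.

Lemma psi_eq0 f :
  psi f = 0 <-> forall d, HHp d f \in HH0_filt G d.
Proof.
split=> [f0 d|f0].
  have : dcomp d (psi f) = 0 by rewrite f0.
  by move/HH0_gr_pi_eq0.
apply: val_inj; apply: functional_extensionality_dep => d.
exact: ((@HH0_gr_pi_eq0 d (hcomp d f)).2 (f0 d)).
Qed.

Lemma psi_brackets h : h \in HP_brackets G -> psi h = 0.
Proof. by move=> hB; apply/psi_eq0 => d; exact: HHp_bracket. Qed.

Lemma HHp_homog d e f : f \is e.-homog -> HHp d f = if d == e then HHc f else 0.
Proof.
move=> fe; rewrite /HHp; have [->|de] := eqVneq d e; first by rewrite pihomog_dE.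
by rewrite (pihomog_ne0 _ fe) ?linear0 // eq_sym.
Qed.

Lemma gr_pi_surj d (u : gr_comp (HH0_filt G) d) :
  exists2 f, f \is d.-homog & HH0_gr_pi G d (hcomp d f) = u.
Proof.
have [v ->] := quot_pi_surj u.
have /HH0_filtP[f fd vf] : submod_incl (HH0_filt G d.+1) v \in HH0_filt G d.+1.
  by case: v.
exists (pihomog mdeg d f); first exact: pihomogP.
apply/quot_piP.
change (HHc (pihomog mdeg d (pihomog mdeg d f)) - submod_incl _ v \in HH0_filt G d).
rewrite vf pihomog_id.
rewrite [X in _ - HHc X](pihomog_partitionE fd) big_ord_recr [HHc (_ + _)]linearD /=.
rewrite opprD addrCA subrr addr0 -scaleN1r rpredZ // linear_sum rpred_sum // => e _.
by apply: HHc_filt; apply: (leq_trans (msize_pihomog e f)).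
Qed.

Lemma psi_surj (x : gr (HH0_filt G)) : exists f, psi f = x.
Proof.
have /asboolP[w xw] : submod_val x \in @finsupp K (gr_comp (HH0_filt G)) by case: x.
have /choice[F FE] d : exists f : OV,
    f \is d.-homog /\ HH0_gr_pi G d (hcomp d f) = submod_val x d.
  by have [f] := gr_pi_surj (submod_val x d); exists f.
exists (\sum_(d < w) F d); apply: val_inj; apply: functional_extensionality_dep => e.
have E : HHp e (\sum_(d < w) F d) = if (e < w)%N then HHc (F e) else 0.
  rewrite linear_sum; case: ltnP => ew.
    rewrite (bigD1 (Ordinal ew)) //= big1 ?addr0 => [|d de].
      by rewrite (HHp_homog e (FE e).1) eqxx.
    rewrite /= (HHp_homog e (FE d).1) eq_sym; case: eqP => // ed.
    by case/eqP: de; apply: val_inj.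
  rewrite big1 // => d _ /=; rewrite (HHp_homog e (FE d).1).
  by case: eqP => // ed; move: ew; rewrite ed leqNgt ltn_ord.
rewrite /= /psi_dprod; case: (ltnP e w) E => ew E; last first.
  by rewrite xw //; apply/HH0_gr_pi_eq0; rewrite -[submod_incl _ _]/(HHp e _) E rpred0.
rewrite -(FE e).2; congr (HH0_gr_pi G e _); apply: val_inj.
by rewrite -[LHS]/(HHp e _) -[RHS]/(HHp e _) E (HHp_homog e (FE e).1) eqxx.
Qed.

(** Evaluated on an arbitrarily chosen lift; [phiE] shows independence of the choice, because [psi]
    kills the brackets. *)
Definition phi (u : HP0 G) : gr (HH0_filt G) := psi (sval (cid (quot_pi_surj u))).

Lemma phiE f : phi (HP0_pi G f) = psi f.
Proof.
rewrite /phi; case: cid => /= g /quot_piP fg.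
by apply/eqP; rewrite eq_sym -subr_eq0 -linearB; apply/eqP/psi_brackets.
Qed.

Lemma phi_linear : linear phi.
Proof.
move=> a u v; have [f ->] := quot_pi_surj u; have [g ->] := quot_pi_surj v.
by rewrite -linearP !phiE linearP.
Qed.

(** Two operators with the same symbol of degree $d$ differ by an operator of degree below $d$, so
    [weyl_of f] may replace any other lift. *)
Lemma phi_canonical : is_canonical phi.
Proof.
move=> d f D u [fd Df] uD; split=> [|e ed]; rewrite phiE; last first.
  apply/HH0_gr_pi_eq0; rewrite -[submod_incl _ _]/(HHp e f) (HHp_homog e fd).
  by case: eqP => // _; rewrite rpred0.
apply/quot_piP.
change (HHp d f - submod_incl _ u \in HH0_filt G d).
rewrite uD (HHp_homog d fd) eqxx /HHc -linearB /=.
apply/asboolP; exists (weyl_of f - D) => //.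
change (N f - submod_incl _ D \in bernstein_op K n d).
by rewrite -opprB -scaleN1r rpredZ.
Qed.

Lemma phi_bij : (forall f, psi f = 0 -> f \in HP_brackets G) -> bijective phi.
Proof.
move=> psi_inj; have surj (x : gr (HH0_filt G)) : exists u, phi u = x.
  by have [f <-] := psi_surj x; exists (HP0_pi G f); exact: phiE.
exists (fun x => sval (cid (surj x))) => [u|x]; case: cid => //= v.
have [f ->] := quot_pi_surj u; have [g ->] := quot_pi_surj v.
rewrite !phiE => fg; apply/quot_piP/psi_inj.
by rewrite linearB /= fg subrr.
Qed.

End Canonical.

(** * A criterion for the canonical map to be an isomorphism *)

(** Coefficients indexed by [nat] avoid casts between the ordinals bounded by the size of a list and
    by that of its image. *)
Lemma is_basis_nat (K : fieldType) (V : lmodType K) (s : seq V) :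
  (forall v, exists c : nat -> K, v = \sum_(i < size s) c i *: s`_i) ->
  (forall c : nat -> K, \sum_(i < size s) c i *: s`_i = 0 ->
     forall i, (i < size s)%N -> c i = 0) ->
  is_basis s.
Proof.
move=> span indep v; have [c vc] := span v; exists [ffun i : 'I_(size s) => c i].
split=> [|c' vc']; first by under eq_bigr do rewrite ffunE.
pose b i := if insub i is Some j then c i - c' j else 0.
have bE (j : 'I_(size s)) : b j = c j - c' j by rewrite /b valK.
have b0 : \sum_(i < size s) b i *: s`_i = 0.
  under eq_bigr do rewrite bE scalerBl.
  by rewrite sumrB -vc -vc' subrr.
apply/ffunP => j; rewrite ffunE; apply/eqP; rewrite -subr_eq0 -bE.
by rewrite (indep _ b0).
Qed.

Section Criterion.
Variables (K : numFieldType) (n : nat) (G : set 'M[K]_n).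
Hypothesis uG : forall A, G A -> A \in unitmx.
Local Notation OV := {mpoly K[n + n]}.
Local Notation N := (@normal_op K n).
Implicit Types (f g : OV) (c : nat -> K).

(** For an invariant $E$ and $A$ in the group, $AEA^{-1}=E$, so the twist disappears and the
    functional takes equal values on $ED$ and $DE$. *)
Lemma gauss_commutator (A M : 'M[K]_n) f : G A -> A *m M = M + 1%:M ->
  HHc G f = 0 -> gauss M f = 0.
Proof.
move=> GA AM /quot_pi_eq0.
have Ninj : injective N by apply/normal_op_inj/pchar_num.
suff H : forall D : DX K n, D \in HH_commutators G ->
    forall h, D = weyl_of h -> gauss M h = 0 by move=> /H; apply.
move=> D; elim/linspan_ind => [h|C [E [B [EG CE]]] h Ch|a C B HC HB h Eh].
- move=> /(congr1 (submod_incl _))/esym h0.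
  suff -> : h = 0 by rewrite -(scale0r (0 : OV)) gaussZ mul0r.
  by apply: Ninj; rewrite linear0; exact: h0.
- have [e Ee] := weyl_of_surj E; have [b Bb] := weyl_of_surj B.
  have [u Nu] := normal_op_comp e b; have [v Nv] := normal_op_comp b e.
  have -> : h = u - v.
    by apply: Ninj; rewrite linearB /= Nu Nv -weyl_ofE -Ch CE Ee Bb.
  rewrite -scaleN1r addrC gaussD gaussZ mulN1r addrC; apply/eqP; rewrite subr_eq0.
  have Ge : fun_act A \o N e \o fun_act (invmx A) = N e.
    by rewrite -weyl_ofE -Ee; exact: EG.
  apply/eqP/(gauss_twisted_trace (uG GA) AM Nu); rewrite Ge; exact: Nv.
- have [x Cx] := weyl_of_surj C; have [y By] := weyl_of_surj B.
  have -> : h = a *: x + y.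
    have : weyl_of h = weyl_of (a *: x + y) by rewrite linearP /= -Eh Cx By.
    by move=> /(congr1 (submod_incl _)) E; apply: Ninj; exact: E.
  by rewrite gaussD gaussZ (HC x Cx) (HB y By) mulr0 addr0.
Qed.

Variable L : seq OV.
Variable deg : nat -> nat.
Hypothesis L_homog : forall i, L`_i \is (deg i).-homog.
Hypothesis L_span : forall f, exists c,
  f - \sum_(i < size L) c i *: L`_i \in HP_brackets G.
(** Indexing the group elements by the positions of [L] encodes the numerical coincidence behind the
    proof: as many traces as spanning elements. *)
Variables A M : 'I_(size L) -> 'M[K]_n.
Hypothesis GA : forall t, G (A t).
Hypothesis AM : forall t, A t *m M t = M t + 1%:M.
Hypothesis M_inj : injective M.

Lemma HHp_comb d c : HHp G d (\sum_(i < size L) c i *: L`_i) =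
  \sum_(i < size L) (if d == deg i then c i else 0) *: HHc G L`_i.
Proof.
rewrite linear_sum; apply: eq_bigr => i _; rewrite linearZ /= (HHp_homog G d (L_homog i)).
by case: eqP => // _; rewrite scaler0 scale0r.
Qed.

(** The condition on [deg i] is the point: the reduction never uses lifts of degree [d] or more. The
    top component of [f] is reduced modulo brackets, which in HH_0 leaves an error of smaller
    degree, treated by induction. *)
Lemma HHc_comb d f : (msize f <= d)%N -> exists2 c,
  (forall i, (d <= deg i)%N -> c i = 0) &
  HHc G f = \sum_(i < size L) c i *: HHc G L`_i.
Proof.
elim: d f => [|d IHd] f fd.
  exists (fun=> 0) => //; rewrite big1 => [|i _]; last by rewrite scale0r.
  by move: fd; rewrite leqn0 msize_poly_eq0 => /eqP ->; rewrite linear0.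
have [c /(HHp_bracket uG d)] := L_span (pihomog mdeg d f).
rewrite linearB /= HHp_comb (HHp_homog G d (pihomogP mdeg d f)) eqxx => /HH0_filtP[g gd E].
pose f' := \sum_(e < d) pihomog mdeg e f.
have f'd : (msize (g + f') <= d)%N.
  apply/deg_lt_msize; rewrite -[g]scale1r; apply: deg_ltD; first exact/deg_lt_msize.
  apply: deg_lt_sum => e; apply/deg_lt_msize.
  by apply: leq_trans (msize_pihomog e f) _.
have [c' c'0 Ec'] := IHd _ f'd.
exists (fun i => (if d == deg i then c i else 0) + c' i) => [i di|].
  by rewrite c'0 ?(ltnW di) // addr0; case: eqP di => // ->; rewrite ltnn.
under eq_bigr do rewrite scalerDl.
rewrite big_split /= -Ec' linearD /= addrA -E addrC.
rewrite {1}[f](pihomog_partitionE fd) big_ord_recr linearD /= -/f'.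
by congr (_ + _); rewrite addrC subrK.
Qed.

(** A relation between the columns of [P] would hold between the traces on every [f], as these
    factor through HH_0, which [L] spans. So the columns are independent, and [P] being square, so
    are its rows. *)
Lemma HHc_indep c : \sum_(i < size L) c i *: HHc G L`_i = 0 ->
  forall i, (i < size L)%N -> c i = 0.
Proof.
move=> c0; pose P := \matrix_(i < size L, t < size L) gauss (M t) L`_i.
have gauss0 t f : HHc G f = 0 -> gauss (M t) f = 0 by exact: gauss_commutator.
have gauss_comb t b : gauss (M t) (\sum_(i < size L) b i *: L`_i) =
    \sum_(i < size L) b i * gauss (M t) L`_i.
  by rewrite gauss_sum; apply: eq_bigr => i _; rewrite gaussZ.
have HHc_sum b : HHc G (\sum_(i < size L) b i *: L`_i) =
    \sum_(i < size L) b i *: HHc G L`_i.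
  by rewrite linear_sum; apply: eq_bigr => i _; rewrite linearZ.
have PTfree : row_free P^T.
  apply: inj_row_free => u uP; apply/rowP => t; rewrite mxE.
  apply: (gauss_independent (c := fun t => u 0 t) M_inj) => f.
  have [b _ Eb] := HHc_comb (leqnn (msize f)).
  have fb s : gauss (M s) f = \sum_(i < size L) b i * gauss (M s) L`_i.
    rewrite -gauss_comb; apply/eqP; rewrite -subr_eq0 -mulN1r -gaussZ -gaussD scaleN1r.
    by apply/eqP/gauss0; rewrite linearB /= HHc_sum Eb subrr.
  under eq_bigr do rewrite fb mulr_sumr.
  rewrite exchange_big big1 // => i _ /=.
  have /rowP/(_ i) := uP; rewrite mxE [RHS]mxE => uPi.
  have {}uPi : \sum_(s < size L) u 0 s * gauss (M s) L`_i = 0.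
    by rewrite -[RHS]uPi; apply: eq_bigr => s _; rewrite !mxE.
  by under eq_bigr do rewrite mulrCA; rewrite -mulr_sumr uPi mulr0.
have Pfree : row_free P by rewrite /row_free -mxrank_tr.
have cP : (\row_(i < size L) c i) *m P = 0.
  apply/rowP => t; rewrite !mxE -[RHS](gauss0 t _ (etrans (HHc_sum c) c0)) gauss_comb.
  by apply: eq_bigr => i _; rewrite !mxE.
move=> i iL; have := row_free_inj Pfree (etrans cP (esym (mul0mx _ P))).
by move=> /rowP/(_ (Ordinal iL)); rewrite !mxE.
Qed.

(** In HH_0 the part of degree [deg i] equals a combination of lifts of smaller degree. The
    resulting relation is trivial, and its coefficient at [i] is unaffected by those smaller
    terms. *)
Lemma psi_comb_eq0 c : psi G (\sum_(i < size L) c i *: L`_i) = 0 ->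
  forall i, (i < size L)%N -> c i = 0.
Proof.
move=> /psi_eq0 c0 i iL.
have := c0 (deg i); rewrite HHp_comb => /HH0_filtP[g gd E].
have [b b0 Eb] := HHc_comb gd.
pose c' j := (if deg i == deg j then c j else 0) - b j.
have c'0 : \sum_(j < size L) c' j *: HHc G L`_j = 0.
  by under eq_bigr do rewrite scalerBl; rewrite sumrB E Eb subrr.
by have := HHc_indep c'0 iL; rewrite /c' eqxx b0 // subr0.
Qed.

Lemma psi_inj f : psi G f = 0 -> f \in HP_brackets G.
Proof.
move=> f0; have [c fc] := L_span f.
have c0 : psi G (\sum_(i < size L) c i *: L`_i) = 0.
  have := psi_brackets uG fc; rewrite linearB /= f0 sub0r => /eqP.
  by rewrite oppr_eq0 => /eqP.
move: fc; rewrite big1 ?subr0 // => i _.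
by rewrite (psi_comb_eq0 c0) ?scale0r.
Qed.

Lemma HP0_iso_basis :
  HP0_iso_gr_HH0 G /\ is_basis [seq HP0_pi G p | p <- L].
Proof.
split.
  pose phi_lin : {linear HP0 G -> gr (HH0_filt G)} := HB.pack (@phi K n G)
    (GRing.isLinear.Build K (HP0 G) (gr (HH0_filt G)) *:%R _ (phi_linear uG)).
  exists phi_lin; split; first exact: phi_canonical.
  exact: phi_bij uG psi_inj.
have comb c : \sum_(i < size [seq HP0_pi G p | p <- L]) c i *: [seq HP0_pi G p | p <- L]`_i =
    HP0_pi G (\sum_(i < size L) c i *: L`_i).
  rewrite linear_sum size_map; apply: eq_bigr => i _.
  by rewrite (nth_map 0) // linearZ.
apply: is_basis_nat => [v|c].
  have [f ->] := quot_pi_surj v; have [c fc] := L_span f; exists c.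
  by rewrite comb; exact/quot_piP.
rewrite comb => c0 i; rewrite size_map; apply: psi_comb_eq0.
by apply: psi_brackets => //; apply/quot_pi_eq0.
Qed.

End Criterion.

(** * Reduction of monomials modulo brackets *)

Section WeightSpan.
Variables (K : numFieldType) (V : lmodType K) (S : submodClosed V).
Variables (m : nat) (w : nat -> nat -> nat -> nat -> V).
Hypothesis hm : (2 <= m)%N.
Implicit Types i j k l p q s n : nat.

(* [w i j k l] stands for the class of [x1^i y1^j x2^k y2^l].  The relations are
   the brackets with [x1 y1 + x2 y2], [(x1 y1)^2 + (x2 y2)^2], [x1^m + x2^m] and
   [y1^m + y2^m]. *)
Hypothesis euler_rel : forall i j k l, (i + k <> j + l)%N -> w i j k l = 0.
Hypothesis shift_rel : forall i j k l, i <> j -> (i + k = j + l)%N ->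
  w i.+1 j.+1 k l = w i j k.+1 l.+1.
Hypothesis x_rel : forall i j k l,
  j%:R *: w (i + m - 1) j.-1 k l + l%:R *: w i j (k + m - 1) l.-1 = 0.
Hypothesis y_rel : forall i j k l,
  i%:R *: w i.-1 (j + m - 1) k l + k%:R *: w i j k.-1 (l + m - 1) = 0.

Hypothesis basis1_in : forall a b, (a < m - 1)%N -> (b < m - 1)%N -> w a a b b \in S.
Hypothesis basis2_in : forall a, (1 <= a < m)%N ->
  w (m - 1) (m - 1) a a + w a a (m - 1) (m - 1) \in S.
Hypothesis basis3_in : forall a b, (1 <= b)%N -> (a + b < m - 1)%N ->
  w (a + b) a 0 b \in S /\ w 0 b (a + b) a \in S.
Hypothesis basis4_in : forall b, (1 <= b < m)%N ->
  b%:R *: w (m - 1) (m - 1 - b) 0 b - (m - b)%:R *: w 0 (m - b) (m - 1) (b - 1) \in S.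

(* [wp s n] and [wm s n] represent the monomials of [x1 y1]-weight [s] and
   [- s], and of degree [2 * (s + n)]. *)
Let wp s n := w (s + n) n 0 s.
Let wm s n := w 0 s (s + n) n.

(** In nonzero weight [shift_rel] exchanges a factor $x_1y_1$ for $x_2y_2$, so only the weight and
    the degree matter. *)
Lemma w_pos s p q : (0 < s)%N -> w (s + p) p q (s + q) = wp s (p + q).
Proof.
move=> s0; elim: q p => [|q IHq] p; first by rewrite /wp !addn0.
rewrite [(s + q.+1)%N]addnS -shift_rel; try lia.
by rewrite -addnS IHq addSnnS.
Qed.

Lemma w_neg s p q : (0 < s)%N -> w p (s + p) (s + q) q = wm s (p + q).
Proof.
move=> s0; elim: p q => [|p IHp] q; first by rewrite /wm addn0.
rewrite [(s + p.+1)%N]addnS shift_rel; try lia.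
by rewrite -addnS IHp addSnnS.
Qed.

Lemma scaler_nat_eq0 k (v : V) : (0 < k)%N -> k%:R *: v = 0 -> v = 0.
Proof.
move=> k0 /eqP; rewrite scaler_eq0 pnatr_eq0 => /orP[|/eqP //].
by rewrite eqn0Ngt k0.
Qed.

Lemma lin2_eq0 (a b c d : K) (u v : V) : a * d - b * c != 0 ->
  a *: u + b *: v = 0 -> c *: u + d *: v = 0 -> u = 0 /\ v = 0.
Proof.
move=> det E1 E2; have U : (a * d - b * c) *: u = 0.
  have : d *: (a *: u + b *: v) - b *: (c *: u + d *: v) = 0 by rewrite E1 E2 !scaler0 subrr.
  rewrite !scalerDr !scalerA opprD addrACA (mulrC d b) subrr addr0 -scalerBl.
  by rewrite (mulrC d).
have W : (a * d - b * c) *: v = 0.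
  have : a *: (c *: u + d *: v) - c *: (a *: u + b *: v) = 0 by rewrite E1 E2 !scaler0 subrr.
  rewrite !scalerDr !scalerA opprD addrACA (mulrC a c) subrr add0r -scalerBl.
  by rewrite (mulrC c).
by move: U W => /eqP + /eqP; rewrite !scaler_eq0 (negPf det) => /eqP + /eqP.
Qed.

Lemma mem_scaler_nat k (v : V) : (0 < k)%N -> k%:R *: v \in S -> v \in S.
Proof.
move=> k0 kv; rewrite -[v]scale1r -(mulVf (x := k%:R)) ?pnatr_eq0 -?lt0n //.
by rewrite -scalerA rpredZ.
Qed.

Lemma zero_x p q : (m - 1 <= p)%N -> (0 < q)%N ->
  p.+1%:R *: w p p q q = - (q%:R *: wm m (p + q - m)).
Proof.
move=> mp q0; have := x_rel (p + 1 - m) p.+1 q q.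
have -> : (p + 1 - m + m - 1 = p)%N by lia.
have -> : w (p + 1 - m) p.+1 (q + m - 1) q.-1 = wm m (p + q - m).
  have := @w_neg m (p + 1 - m) q.-1; rewrite (_ : p + 1 - m + q.-1 = p + q - m)%N; last by lia.
  by move=> <-; [congr w; lia|lia].
by move/eqP; rewrite addr_eq0 => /eqP.
Qed.

Lemma zero_x' p q : (m - 1 <= q)%N -> (0 < p)%N ->
  q.+1%:R *: w p p q q = - (p%:R *: wp m (p + q - m)).
Proof.
move=> mq p0; have := x_rel p p (q + 1 - m) q.+1.
have -> : (q + 1 - m + m - 1 = q)%N by lia.
have -> : w (p + m - 1) p.-1 (q + 1 - m) q.+1 = wp m (p + q - m).
  have := @w_pos m p.-1 (q + 1 - m); rewrite (_ : p.-1 + (q + 1 - m) = p + q - m)%N; last by lia.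
  by move=> <-; [congr w; lia|lia].
by move/eqP; rewrite addrC addr_eq0 => /eqP.
Qed.

Lemma zero_y p q : (m - 1 <= p)%N -> (0 < q)%N ->
  p.+1%:R *: w p p q q = - (q%:R *: wp m (p + q - m)).
Proof.
move=> mp q0; have := y_rel p.+1 (p + 1 - m) q q.
have -> : (p + 1 - m + m - 1 = p)%N by lia.
have -> : w p.+1 (p + 1 - m) q.-1 (q + m - 1) = wp m (p + q - m).
  have := @w_pos m (p + 1 - m) q.-1; rewrite (_ : p + 1 - m + q.-1 = p + q - m)%N; last by lia.
  by move=> <-; [congr w; lia|lia].
by move/eqP; rewrite addr_eq0 => /eqP.
Qed.

Lemma zero_y' p q : (m - 1 <= q)%N -> (0 < p)%N ->
  q.+1%:R *: w p p q q = - (p%:R *: wm m (p + q - m)).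
Proof.
move=> mq p0; have := y_rel p p q.+1 (q + 1 - m).
have -> : (q + 1 - m + m - 1 = q)%N by lia.
have -> : w p.-1 (p + m - 1) q.+1 (q + 1 - m) = wm m (p + q - m).
  have := @w_neg m p.-1 (q + 1 - m); rewrite (_ : p.-1 + (q + 1 - m) = p + q - m)%N; last by lia.
  by move=> <-; [congr w; lia|lia].
by move/eqP; rewrite addrC addr_eq0 => /eqP.
Qed.

Lemma zero_q0 p : (m - 1 <= p)%N -> w p p 0 0 = 0.
Proof.
move=> mp; apply: (@scaler_nat_eq0 p.+1) => //.
have := x_rel (p + 1 - m) p.+1 0 0; rewrite scale0r addr0 => <-.
by congr (_ *: w _ _ _ _); lia.
Qed.

Lemma zero_p0 q : (m - 1 <= q)%N -> w 0 0 q q = 0.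
Proof.
move=> mq; apply: (@scaler_nat_eq0 q.+1) => //.
have := x_rel 0 0 (q + 1 - m) q.+1; rewrite scale0r add0r => <-.
by congr (_ *: w _ _ _ _); lia.
Qed.

Lemma submod_memN (v : V) : v \in S -> - v \in S.
Proof. by move=> vS; rewrite -scaleN1r rpredZ. Qed.

(** Used for both weights $\pm m$. The class is proportional to each half of a member of the second
    family with the same constant; adding the two equations brings in their sum. *)
Lemma wm_wp_m_in (v : V) n :
  ((n.+1)%:R *: v = - (m%:R *: w (m - 1) (m - 1) n.+1 n.+1)) ->
  ((n.+1)%:R *: v = - (m%:R *: w n.+1 n.+1 (m - 1) (m - 1))) ->
  ((m - 1 <= n)%N -> v = 0) -> v \in S.
Proof.
move=> E1 E2 big; case: (leqP (m - 1) n) => [/big ->|nm]; first exact: rpred0.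
apply: (@mem_scaler_nat n.+1) => //; apply: (@mem_scaler_nat 2) => //.
rewrite scaler_nat mulr2n {1}E1 E2 -opprD -scalerDr submod_memN ?rpredZ //.
by apply: basis2_in; lia.
Qed.

(** Beyond the range of the second family two relations bear on the same two classes, with
    determinant $m(m-1)-(n+1)(n+2)<0$. *)
Lemma wm_wp_m_big (v : V) n : (m - 1 <= n)%N ->
  m%:R *: w (m - 1) (m - 1) n.+1 n.+1 = - (n.+1%:R *: v) ->
  n.+2%:R *: w (m - 1) (m - 1) n.+1 n.+1 = - ((m - 1)%:R *: v) -> v = 0.
Proof.
move=> mn /eqP; rewrite -addr_eq0 => /eqP E1 /eqP; rewrite -addr_eq0 => /eqP E2.
have [] // := lin2_eq0 _ E1 E2.
rewrite -!natrM subr_eq0 eqr_nat; apply/eqP => E.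
have : (m * (m - 1) < n.+1 * n.+2)%N.
  by apply: (@leq_trans (n.+1 * n.+1)); [nia|rewrite leq_mul].
by rewrite E ltnn.
Qed.

Lemma wm_m_in n : wm m n \in S.
Proof.
have m1 : (m - 1).+1 = m by lia.
have mn1 : (m - 1 + n.+1 - m)%N = n by lia.
have mn2 : (n.+1 + (m - 1) - m)%N = n by lia.
have := @zero_x (m - 1) n.+1 (leqnn _) isT; rewrite m1 mn1 => E1.
have := @zero_y' n.+1 (m - 1) (leqnn _) isT; rewrite m1 mn2 => E2.
apply: (@wm_wp_m_in _ n); [by rewrite E1 opprK|by rewrite E2 opprK|] => mn.
apply: (wm_wp_m_big mn E1).
by have := @zero_y' (m - 1) n.+1; rewrite mn1; apply; clear E1 E2; lia.
Qed.

Lemma wp_m_in n : wp m n \in S.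
Proof.
have m1 : (m - 1).+1 = m by lia.
have mn1 : (m - 1 + n.+1 - m)%N = n by lia.
have mn2 : (n.+1 + (m - 1) - m)%N = n by lia.
have := @zero_y (m - 1) n.+1 (leqnn _) isT; rewrite m1 mn1 => E1.
have := @zero_x' n.+1 (m - 1) (leqnn _) isT; rewrite m1 mn2 => E2.
apply: (@wm_wp_m_in _ n); [by rewrite E1 opprK|by rewrite E2 opprK|] => mn.
apply: (wm_wp_m_big mn E1).
by have := @zero_x' (m - 1) n.+1; rewrite mn1; apply; clear E1 E2; lia.
Qed.

Lemma zero_in p q : w p p q q \in S.
Proof.
have [mp|pm] := leqP (m - 1) p.
  have [->|q0] := posnP q; first by rewrite zero_q0 // rpred0.
  by apply: (@mem_scaler_nat p.+1) => //; rewrite zero_x // submod_memN ?rpredZ ?wm_m_in.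
have [mq|qm] := leqP (m - 1) q; last exact: basis1_in.
have [->|p0] := posnP p; first by rewrite zero_p0 // rpred0.
by apply: (@mem_scaler_nat q.+1) => //; rewrite zero_x' // submod_memN ?rpredZ ?wp_m_in.
Qed.

(** Both $s$ and $s-m$ are positive, so the relations couple only two classes. The relation with
    $j=0$ kills the class of weight $s-m$, then the one with $j=n+1$ kills the other. *)
Lemma wp_big s n : (m < s)%N -> wp s n = 0.
Proof.
move=> ms; apply: (@scaler_nat_eq0 n.+1) => //.
have rel j l' : (j + l' = n.+1)%N ->
    j%:R *: wp s n + (s + l')%:R *: wp (s - m) (n + m) = 0.
  move=> jl; rewrite -[RHS](x_rel (j + s - m) j l' (s + l')).
  congr (_ + _ *: _); last first.
    rewrite -(_ : j + (l' + m - 1) = n + m)%N; last by lia.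
    by rewrite -w_pos; [congr w; lia|lia].
  have [->|j0] := posnP j; first by rewrite !scale0r.
  rewrite -(_ : j.-1 + l' = n)%N; last by lia.
  by rewrite -w_pos; [congr (_ *: w _ _ _ _); lia|lia].
have W0 : wp (s - m) (n + m) = 0.
  apply: (@scaler_nat_eq0 (s + n.+1)); first by lia.
  by rewrite -[RHS](rel 0 n.+1) // scale0r add0r.
by have := rel n.+1 0; rewrite W0 scaler0 addr0; apply; lia.
Qed.

Lemma wm_big s n : (m < s)%N -> wm s n = 0.
Proof.
move=> ms; apply: (@scaler_nat_eq0 n.+1) => //.
have rel i k' : (i + k' = n.+1)%N ->
    i%:R *: wm s n + (s + k')%:R *: wm (s - m) (n + m) = 0.
  move=> jl; rewrite -[RHS](y_rel i (i + s - m) (s + k') k').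
  congr (_ + _ *: _); last first.
    rewrite -(_ : i + (k' + m - 1) = n + m)%N; last by lia.
    by rewrite -w_neg; [congr w; lia|lia].
  have [->|i0] := posnP i; first by rewrite !scale0r.
  rewrite -(_ : i.-1 + k' = n)%N; last by lia.
  by rewrite -w_neg; [congr (_ *: w _ _ _ _); lia|lia].
have W0 : wm (s - m) (n + m) = 0.
  apply: (@scaler_nat_eq0 (s + n.+1)); first by lia.
  by rewrite -[RHS](rel 0 n.+1) // scale0r add0r.
by have := rel n.+1 0; rewrite W0 scaler0 addr0; apply; lia.
Qed.

(* The weights [s] and [s - m] are coupled by one relation in degree
   [2 * (m - 1)], hence the fourth family of the basis, and by at least two
   independent ones in higher degrees. *)
Lemma pair_rel s e j' : (0 < s < m)%N -> (j' <= e)%N ->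
  (m - s + j')%:R *: wp s (m - 1 - s + e) + (s + e - j')%:R *: wm (m - s) (s - 1 + e) = 0.
Proof.
move=> sm je; rewrite -[RHS](x_rel j' (m - s + j') (e - j') (s + (e - j'))).
congr (_ *: _ + _ *: _); last 1 first.
- rewrite -(_ : j' + (s - 1 + (e - j')) = s - 1 + e)%N; last by lia.
  by rewrite -w_neg; [congr w; lia|lia].
- rewrite -(_ : (m - 1 - s + j') + (e - j') = m - 1 - s + e)%N; last by lia.
  by rewrite -w_pos; [congr w; lia|lia].
- by congr (_%:R); lia.
Qed.

(** The extreme relations [j' = 0] and [j' = e] have determinant $(m-s)s-(s+e)(m-s+e)<0$. *)
Lemma pair_big s e : (0 < s < m)%N -> (0 < e)%N ->
  wp s (m - 1 - s + e) = 0 /\ wm (m - s) (s - 1 + e) = 0.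
Proof.
move=> sm e0; apply: lin2_eq0 (pair_rel sm (leq0n e)) (pair_rel sm (leqnn e)).
rewrite -!natrM subr_eq0 eqr_nat; apply/eqP; nia.
Qed.

Lemma sumsq_scale_l (a b : K) (u v : V) :
  (a * a + b * b) *: u = b *: (b *: u - a *: v) + a *: (a *: u + b *: v).
Proof.
rewrite !scalerDr !scalerN !scalerA (mulrC b a) scalerDl [RHS]addrACA addNr.
by rewrite addr0 addrC.
Qed.

Lemma sumsq_scale_r (a b : K) (u v : V) :
  (a * a + b * b) *: v = b *: (a *: u + b *: v) - a *: (b *: u - a *: v).
Proof.
rewrite !scalerDr !scalerN opprD opprK !scalerA (mulrC b a) scalerDl.
by rewrite [RHS]addrACA subrr add0r addrC.
Qed.

(** The only relation is $(m-s)u+sv=0$. The fourth family with $b=s$ supplies the orthogonal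
    combination $su-(m-s)v$, and the determinant is the sum of squares $(m-s)^2+s^2$. *)
Lemma pair_mid s : (0 < s < m)%N ->
  wp s (m - 1 - s) \in S /\ wm (m - s) (s - 1) \in S.
Proof.
move=> sm; have := pair_rel sm (leq0n 0); rewrite !addn0 subn0.
set u := wp _ _; set v := wm _ _ => E.
have B : s%:R *: u - (m - s)%:R *: v \in S.
  have e1 : (s + (m - 1 - s) = m - 1)%N by clear E; lia.
  have e2 : (m - s + (s - 1) = m - 1)%N by clear E; lia.
  by have := basis4_in sm; rewrite /u /v /wp /wm e1 e2.
have d0 : (0 < (m - s) * (m - s) + s * s)%N by clear E B; nia.
split; apply: (mem_scaler_nat d0); rewrite natrD !natrM.
  by rewrite (sumsq_scale_l _ _ u v) E scaler0 addr0 rpredZ.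
by rewrite (sumsq_scale_r _ _ u v) E scaler0 sub0r submod_memN ?rpredZ.
Qed.

Lemma wp_in s n : (0 < s)%N -> wp s n \in S.
Proof.
move=> s0; case: (ltngtP s m) => [sm|ms|->]; last exact: wp_m_in.
  case: (ltngtP (s + n) (m - 1)) => [le|gt|eq].
  - by have [] := @basis3_in n s s0 _; rewrite addnC.
  - have [] := @pair_big s (n - (m - 1 - s)); try lia.
    by rewrite subnKC => [-> _|]; [exact: rpred0|lia].
  - have e : (m - 1 - s = n)%N by lia.
    by have [] := @pair_mid s; [lia|rewrite e].
by rewrite wp_big // rpred0.
Qed.

Lemma wm_in s n : (0 < s)%N -> wm s n \in S.
Proof.
move=> s0; case: (ltngtP s m) => [sm|ms|->]; last exact: wm_m_in.
  case: (ltngtP (s + n) (m - 1)) => [le|gt|eq].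
  - by have [] := @basis3_in n s s0 _; rewrite addnC.
  - have [] := @pair_big (m - s) (n - (m - s - 1)); try lia.
    rewrite subKn ?subnKC => [_ ->||]; [exact: rpred0|lia|lia].
  - have e : (m - s - 1 = n)%N by lia.
    by have [] := @pair_mid (m - s); [lia|rewrite (subKn (ltnW sm)) e].
by rewrite wm_big // rpred0.
Qed.

Lemma weight_span i j k l : w i j k l \in S.
Proof.
have [ikjl|/eqP/euler_rel ->] := eqVneq (i + k)%N (j + l)%N; last exact: rpred0.
case: (ltngtP i j) => [ij|ji|ij].
- rewrite (_ : w i j k l = wm (j - i) (i + l)); first by apply: wm_in; lia.
  by rewrite -w_neg; [congr w; lia|lia].
- rewrite (_ : w i j k l = wp (i - j) (j + k)); first by apply: wp_in; lia.
  by rewrite -w_pos; [congr w; lia|lia].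
- by rewrite ij (_ : k = l); [exact: zero_in|lia].
Qed.

End WeightSpan.

(** * The group G(m,1,2) *)

Lemma linspan_seq (K : fieldType) (V : lmodType K) (s : seq V) v :
  v \in linspan [set x | x \in s]%classic ->
  exists c : nat -> K, v = \sum_(i < size s) c i *: s`_i.
Proof.
elim/linspan_ind => [|x /= xs|a x y [c ->] [d ->]].
- by exists (fun=> 0); rewrite big1 // => i _; rewrite scale0r.
- exists (fun i => (i == index x s)%:R).
  have xi : (index x s < size s)%N by rewrite index_mem.
  rewrite (bigD1 (Ordinal xi)) //= eqxx scale1r nth_index // big1 ?addr0 // => i.
  by rewrite -val_eqE /= => /negPf ->; rewrite scale0r.
- exists (fun i => a * c i + d i); rewrite scaler_sumr -big_split.
  by apply: eq_bigr => i _ /=; rewrite scalerDl scalerA.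
Qed.

Lemma invmx_unique (K : fieldType) n (A B : 'M[K]_n) : A *m B = 1%:M -> invmx A = B.
Proof.
move=> AB; have [uA _] := mulmx1_unit AB.
by rewrite -[LHS]mulmx1 -AB mulmxA mulVmx // mul1mx.
Qed.

Section Matrices22.
Variables (K : fieldType) (m : nat).
Hypothesis m0 : (0 < m)%N.

Definition dmx (a b : K) : 'M[K]_2 :=
  \matrix_(i, j) (if i == j then if i == 0 then a else b else 0).
Definition amx (a b : K) : 'M[K]_2 :=
  \matrix_(i, j) (if i == j then 0 else if i == 0 then a else b).

Lemma ord2P (P : 'I_2 -> Prop) : P 0 -> P 1 -> forall i, P i.
Proof.
move=> P0 P1 i; have [->//|i0] := eqVneq i 0.
by rewrite (_ : i = 1) //; apply/val_inj; case: i i0 => -[|[|]].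
Qed.

Lemma sum2 (V : nmodType) (F : 'I_2 -> V) : \sum_i F i = F 0 + F 1.
Proof. by rewrite big_ord_recl big_ord1; congr (_ + F _); apply/val_inj. Qed.

Lemma dmxM a b c d : dmx a b *m dmx c d = dmx (a * c) (b * d).
Proof.
apply/matrixP; elim/ord2P; elim/ord2P; rewrite !mxE sum2 !mxE /=; ring.
Qed.

Lemma amxM a b c d : amx a b *m amx c d = dmx (a * d) (b * c).
Proof.
apply/matrixP; elim/ord2P; elim/ord2P; rewrite !mxE sum2 !mxE /=; ring.
Qed.

Lemma dmx1 : dmx 1 1 = 1%:M.
Proof. by apply/matrixP; elim/ord2P; elim/ord2P; rewrite !mxE. Qed.

Lemma invmx_dmx a b : a != 0 -> b != 0 -> invmx (dmx a b) = dmx a^-1 b^-1.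
Proof. by move=> a0 b0; apply: invmx_unique; rewrite dmxM !divff // dmx1. Qed.

Lemma invmx_amx a b : a != 0 -> b != 0 -> invmx (amx a b) = amx b^-1 a^-1.
Proof. by move=> a0 b0; apply: invmx_unique; rewrite amxM !divff // dmx1. Qed.

Lemma dmx_unit a b : a != 0 -> b != 0 -> dmx a b \in unitmx.
Proof.
move=> a0 b0; have E : dmx a b *m dmx a^-1 b^-1 = 1%:M by rewrite dmxM !divff // dmx1.
by case: (mulmx1_unit E).
Qed.

Lemma amx_unit a b : a != 0 -> b != 0 -> amx a b \in unitmx.
Proof.
move=> a0 b0; have E : amx a b *m amx b^-1 a^-1 = 1%:M by rewrite amxM !divff // dmx1.
by case: (mulmx1_unit E).
Qed.

Lemma G_m1_2P (A : 'M[K]_2) : G_m1 K m 2 A -> exists a b,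
  [/\ a ^+ m = 1, b ^+ m = 1, a != 0, b != 0 & A = dmx a b \/ A = amx a b].
Proof.
move=> [[rowA colA] rootA].
have offr i j j' : A i j != 0 -> j' != j -> A i j' = 0.
  have [l [_ ul]] := rowA i => /ul jl jj'.
  by apply/eqP; apply: contraNT jj' => /ul <-; rewrite jl.
have offc i i' j : A i j != 0 -> i' != i -> A i' j = 0.
  have [l [_ ul]] := colA j => /ul jl jj'.
  by apply/eqP; apply: contraNT jj' => /ul <-; rewrite jl.
have [A00|A00] := eqVneq (A 0 0) 0.
  have A01 : A 0 1 != 0.
    by have [j [+ _]] := rowA 0; elim/ord2P: j; rewrite ?A00 ?eqxx.
  have A11 : A 1 1 = 0 by apply: (offc 0).
  have A10 : A 1 0 != 0.
    by have [j [+ _]] := rowA 1; elim/ord2P: j; rewrite ?A11 ?eqxx.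
  exists (A 0 1), (A 1 0); split; rewrite ?rootA //; right.
  by apply/matrixP; elim/ord2P; elim/ord2P; rewrite !mxE.
have A01 : A 0 1 = 0 by apply: (offr 0 0).
have A10 : A 1 0 = 0 by apply: (offc 0).
have A11 : A 1 1 != 0.
  by have [j [+ _]] := rowA 1; elim/ord2P: j; rewrite ?A10 ?eqxx.
exists (A 0 0), (A 1 1); split; rewrite ?rootA //; left.
by apply/matrixP; elim/ord2P; elim/ord2P; rewrite !mxE.
Qed.

Lemma root1_neq0 (c : K) : c ^+ m = 1 -> c != 0.
Proof.
move=> cm; apply/eqP => c0; move/eqP: cm.
by rewrite c0 expr0n eqn0Ngt m0 eq_sym oner_eq0.
Qed.

Lemma G_m1_dmx a b : a ^+ m = 1 -> b ^+ m = 1 -> G_m1 K m 2 (dmx a b).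
Proof.
move=> am bm; have [a0 b0] := (root1_neq0 am, root1_neq0 bm); split; last first.
  by elim/ord2P; elim/ord2P; rewrite !mxE /= ?eqxx.
split; elim/ord2P; [exists 0|exists 1|exists 0|exists 1]; split; rewrite ?mxE //;
  by elim/ord2P; rewrite ?mxE /= ?eqxx.
Qed.

Lemma G_m1_amx a b : a ^+ m = 1 -> b ^+ m = 1 -> G_m1 K m 2 (amx a b).
Proof.
move=> am bm; have [a0 b0] := (root1_neq0 am, root1_neq0 bm); split; last first.
  by elim/ord2P; elim/ord2P; rewrite !mxE /= ?eqxx.
split; elim/ord2P; [exists 1|exists 0|exists 1|exists 0]; split; rewrite ?mxE //;
  by elim/ord2P; rewrite ?mxE /= ?eqxx.
Qed.

Lemma G_m1_unit A : G_m1 K m 2 A -> A \in unitmx.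
Proof.
by case/G_m1_2P => a [b [_ _ a0 b0 [] ->]]; [exact: dmx_unit|exact: amx_unit].
Qed.

Local Notation x1 := (x1 K).
Local Notation x2 := (x2 K).
Local Notation y1 := (y1 K).
Local Notation y2 := (y2 K).

Lemma fun_actXn n (A : 'M[K]_n) p k : fun_act A (p ^+ k) = fun_act A p ^+ k.
Proof. by rewrite /fun_act rmorphXn. Qed.

Lemma fun_act_dmx a b (a0 : a != 0) (b0 : b != 0)
  (act := fun_act (sp_embed (dmx a b))) :
  [/\ act x1 = a^-1 *: x1, act x2 = b^-1 *: x2, act y1 = a *: y1 & act y2 = b *: y2].
Proof.
have u := dmx_unit a0 b0.
split; rewrite /act ?(fun_act_sp_x u) ?(fun_act_sp_y u) sum2 ?invmx_dmx // !mxE /=;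
  by rewrite scale0r ?addr0 ?add0r.
Qed.

Lemma fun_act_amx a b (a0 : a != 0) (b0 : b != 0)
  (act := fun_act (sp_embed (amx a b))) :
  [/\ act x1 = b^-1 *: x2, act x2 = a^-1 *: x1, act y1 = b *: y2 & act y2 = a *: y1].
Proof.
have u := amx_unit a0 b0.
split; rewrite /act ?(fun_act_sp_x u) ?(fun_act_sp_y u) sum2 ?invmx_amx // !mxE /=;
  by rewrite scale0r ?addr0 ?add0r.
Qed.

Lemma inv_x : OV_inv (G_m1 K m 2) (x1 ^+ m + x2 ^+ m).
Proof.
move=> A /G_m1_2P[a [b [am bm a0 b0 [] ->]]]; rewrite fun_actD !fun_actXn.
  by have [-> -> _ _] := fun_act_dmx a0 b0; rewrite !exprZn !exprVn am bm invr1 !scale1r.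
have [-> -> _ _] := fun_act_amx a0 b0; rewrite !exprZn !exprVn am bm invr1 !scale1r.
exact: addrC.
Qed.

Lemma inv_y : OV_inv (G_m1 K m 2) (y1 ^+ m + y2 ^+ m).
Proof.
move=> A /G_m1_2P[a [b [am bm a0 b0 [] ->]]]; rewrite fun_actD !fun_actXn.
  by have [_ _ -> ->] := fun_act_dmx a0 b0; rewrite !exprZn am bm !scale1r.
have [_ _ -> ->] := fun_act_amx a0 b0; rewrite !exprZn am bm !scale1r.
exact: addrC.
Qed.

Lemma inv_xy k : OV_inv (G_m1 K m 2) ((x1 * y1) ^+ k + (x2 * y2) ^+ k).
Proof.
move=> A /G_m1_2P[a [b [am bm a0 b0 [] ->]]]; rewrite fun_actD !fun_actXn !fun_actM.
  have [-> -> -> ->] := fun_act_dmx a0 b0.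
  by rewrite -!scalerAl -!scalerAr !scalerA !mulVf // !scale1r.
have [-> -> -> ->] := fun_act_amx a0 b0.
rewrite -!scalerAl -!scalerAr !scalerA !mulVf // !scale1r; exact: addrC.
Qed.

Definition mon i j k l := x1 ^+ i * y1 ^+ j * x2 ^+ k * y2 ^+ l.

Lemma mon_homog i j k l : mon i j k l \is (i + j + k + l).-homog.
Proof.
have H v e : ('X_v : {mpoly K[2 + 2]}) ^+ e \is e.-homog.
  by rewrite -[X in X.-homog]mul1n; apply: dhomogMn; rewrite dhomogX /= mdeg1.
exact: dhomogM (dhomogM (dhomogM (H _ _) (H _ _)) (H _ _)) (H _ _).
Qed.

Lemma mpolyX_mon (k : 'X_{1..2 + 2}) :
  'X_[k] = mon (k (lshift 2 0)) (k (rshift 2 0)) (k (lshift 2 1)) (k (rshift 2 1)).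
Proof.
rewrite mpolyXE_id big_split_ord /= !big_ord_recl !big_ord0 !mulr1.
have -> : lift ord0 ord0 = 1 :> 'I_2 by apply/val_inj.
by rewrite /mon mulrA; congr (_ * _); exact: mulrAC.
Qed.

Let ord01 : (0 == 1 :> 'I_2) = false. Proof. by []. Qed.
Let ord10 : (1 == 0 :> 'I_2) = false. Proof. by []. Qed.
Let simpE := (eq_lshift, eq_rshift, eq_lrshift, eq_rlshift, ord01, ord10, eqxx,
  mulr0, mul0r, scaler0, addr0, add0r, mulr1).

Lemma mon_x1 i j k l : (mon i j k l)^`M(lshift 2 0) = i%:R *: mon i.-1 j k l.
Proof. by rewrite /mon !mderivM !mderiv_expn !mderivXU !simpE -!scalerAl. Qed.

Lemma mon_y1 i j k l : (mon i j k l)^`M(rshift 2 0) = j%:R *: mon i j.-1 k l.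
Proof. by rewrite /mon !mderivM !mderiv_expn !mderivXU !simpE -!(scalerAl, scalerAr). Qed.

Lemma mon_x2 i j k l : (mon i j k l)^`M(lshift 2 1) = k%:R *: mon i j k.-1 l.
Proof. by rewrite /mon !mderivM !mderiv_expn !mderivXU !simpE -!(scalerAl, scalerAr). Qed.

Lemma mon_y2 i j k l : (mon i j k l)^`M(rshift 2 1) = l%:R *: mon i j k l.-1.
Proof. by rewrite /mon !mderivM !mderiv_expn !mderivXU !simpE -!(scalerAl, scalerAr). Qed.

End Matrices22.

(** * The relations from explicit invariants; size of the listed family *)

Section Relations.
Variables (K : numFieldType) (m : nat).
Hypothesis hm : (2 <= m)%N.
Local Notation G := (G_m1 K m 2).
Local Notation x1 := (x1 K).
Local Notation x2 := (x2 K).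
Local Notation y1 := (y1 K).
Local Notation y2 := (y2 K).
Local Notation mon := (mon K).

Lemma mulx1 e i j k l : x1 ^+ e * mon i j k l = mon (e + i) j k l.
Proof. by rewrite /mon exprD; ring. Qed.
Lemma mulx2 e i j k l : x2 ^+ e * mon i j k l = mon i j (e + k) l.
Proof. by rewrite /mon exprD; ring. Qed.
Lemma muly1 e i j k l : y1 ^+ e * mon i j k l = mon i (e + j) k l.
Proof. by rewrite /mon exprD; ring. Qed.
Lemma muly2 e i j k l : y2 ^+ e * mon i j k l = mon i j k (e + l).
Proof. by rewrite /mon exprD; ring. Qed.

Lemma bracket_x1 h : bracket x1 h = h^`M(rshift 2 0).
Proof. exact: bracketXl. Qed.
Lemma bracket_x2 h : bracket x2 h = h^`M(rshift 2 1).
Proof. exact: bracketXl. Qed.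
Lemma bracket_y1 h : bracket y1 h = - h^`M(lshift 2 0).
Proof. exact: bracketYl. Qed.
Lemma bracket_y2 h : bracket y2 h = - h^`M(lshift 2 1).
Proof. exact: bracketYl. Qed.

Lemma bracket_u1 i j k l :
  bracket (x1 * y1) (mon i j k l) = (j%:R - i%:R) *: mon i j k l.
Proof.
rewrite bracketMl bracket_x1 bracket_y1 mon_x1 mon_y1 mulrN -scalerAr -scalerAl.
rewrite -[x1]expr1 mulx1 mulrC -[y1]expr1 muly1 scalerBl addrC.
by case: i => [|i]; case: j => [|j]; rewrite ?scale0r.
Qed.

Lemma bracket_u2 i j k l :
  bracket (x2 * y2) (mon i j k l) = (l%:R - k%:R) *: mon i j k l.
Proof.
rewrite bracketMl bracket_x2 bracket_y2 mon_x2 mon_y2 mulrN -scalerAr -scalerAl.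
rewrite -[x2]expr1 mulx2 mulrC -[y2]expr1 muly2 scalerBl addrC.
by case: k => [|k]; case: l => [|l]; rewrite ?scale0r.
Qed.

Definition wt i j k l : HP0 G := HP0_pi G (mon i j k l).

Lemma HP0_piZ a f : HP0_pi G (a *: f) = a *: HP0_pi G f.
Proof. exact: linearZ_LR. Qed.

Lemma HP0_piB f g : HP0_pi G (f - g) = HP0_pi G f - HP0_pi G g.
Proof. exact: linearB. Qed.

Lemma HP0_piD f g : HP0_pi G (f + g) = HP0_pi G f + HP0_pi G g.
Proof. exact: linearD. Qed.

Lemma HP0_pi_bracket f h : OV_inv G f -> HP0_pi G (bracket f h) = 0.
Proof. by move=> fG; apply/quot_pi_eq0/linspan_gen; exists f, h. Qed.

Lemma scale_cancel (V : lmodType K) (a : K) (v : V) : a != 0 -> a *: v = 0 -> v = 0.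
Proof. by move=> a0 /eqP; rewrite scaler_eq0 (negPf a0) => /eqP. Qed.

Lemma wt_euler i j k l : (i + k <> j + l)%N -> wt i j k l = 0.
Proof.
move=> ne; have := HP0_pi_bracket (mon i j k l) (@inv_xy K m 1).
rewrite !expr1 bracketDl bracket_u1 bracket_u2 -scalerDl HP0_piZ.
apply: scale_cancel; rewrite addrACA -opprD -!natrD subr_eq0 eqr_nat.
by apply/eqP => E; apply: ne.
Qed.

(** Brackets with $x_1y_1$ and $x_2y_2$ scale a monomial by $j-i$ and $l-k$, which are opposite
    here. The sum of squares therefore gives $2(j-i)$ times the difference of the two classes. *)
Lemma wt_shift i j k l : i <> j -> (i + k = j + l)%N ->
  wt i.+1 j.+1 k l = wt i j k.+1 l.+1.
Proof.
move=> ne E; have := HP0_pi_bracket (mon i j k l) (@inv_xy K m 2).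
rewrite bracketDl !bracket_expn /= !expr1 bracket_u1 bracket_u2.
have -> : l%:R - k%:R = - (j%:R - i%:R) :> K.
  have : (i + k)%:R = (j + l)%:R :> K by rewrite E.
  rewrite !natrD => E'; apply/eqP; rewrite eq_sym -subr_eq0; apply/eqP.
  by rewrite opprB opprB addrACA E'; ring.
rewrite scaleNr mulrN scalerN -!scalerAr -scalerBr -scalerBr !HP0_piZ.
move=> /(scale_cancel _) H; apply/eqP; rewrite -subr_eq0 -HP0_piB.
apply/eqP; apply: (@scale_cancel _ (j%:R - i%:R)).
  by rewrite subr_eq0 eqr_nat; apply/eqP => /esym.
have := H; rewrite pnatr_eq0 => /(_ isT) <-.
congr (_ *: HP0_pi G (_ - _)).
  by rewrite -mulrA -[y1]expr1 muly1 -[x1]expr1 mulx1.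
by rewrite -mulrA -[y2]expr1 muly2 -[x2]expr1 mulx2.
Qed.

Lemma wt_x i j k l :
  j%:R *: wt (i + m - 1) j.-1 k l + l%:R *: wt i j (k + m - 1) l.-1 = 0.
Proof.
apply: (@scale_cancel _ m%:R); first by rewrite pnatr_eq0; lia.
rewrite -[RHS](HP0_pi_bracket (mon i j k l) (@inv_x K m)).
rewrite bracketDl !bracket_expn bracket_x1 bracket_x2 mon_y1 mon_y2 -!scalerAr.
rewrite mulx1 mulx2 -scalerDr HP0_piZ HP0_piD !HP0_piZ.
have e1 : (m.-1 + i = i + m - 1)%N by lia.
have e2 : (m.-1 + k = k + m - 1)%N by lia.
by rewrite e1 e2.
Qed.

Lemma wt_y i j k l :
  i%:R *: wt i.-1 (j + m - 1) k l + k%:R *: wt i j k.-1 (l + m - 1) = 0.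
Proof.
apply: (@scale_cancel _ (- m%:R)); first by rewrite oppr_eq0 pnatr_eq0; lia.
rewrite -[RHS](HP0_pi_bracket (mon i j k l) (@inv_y K m)).
rewrite bracketDl !bracket_expn bracket_y1 bracket_y2 mon_x1 mon_x2 !mulrN -!scalerAr.
rewrite muly1 muly2 -scalerDr -opprD scalerN -scaleNr HP0_piZ HP0_piD !HP0_piZ.
have e1 : (m.-1 + j = j + m - 1)%N by lia.
have e2 : (m.-1 + l = l + m - 1)%N by lia.
by rewrite e1 e2.
Qed.

Local Notation L := (HP0_basis K m).
Local Notation S := (linspan [set x | x \in [seq HP0_pi G p | p <- L]]%classic).

Lemma basis_in p : p \in L -> HP0_pi G p \in S.
Proof. by move=> pL; apply: linspan_gen; rewrite /= map_f. Qed.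

Lemma mon_basis1 a b : x1 ^+ a * x2 ^+ b * y1 ^+ a * y2 ^+ b = mon a a b b.
Proof. by rewrite /mon -!mulrA; congr (_ * _); rewrite mulrCA. Qed.

Lemma mon_basis3 a b : x1 ^+ (a + b) * y1 ^+ a * y2 ^+ b = mon (a + b) a 0 b.
Proof. by rewrite /mon expr0 mulr1. Qed.

Lemma mon_basis3' a b : x2 ^+ (a + b) * y1 ^+ b * y2 ^+ a = mon 0 b (a + b) a.
Proof. by rewrite /mon expr0 mul1r (mulrC (x2 ^+ _)). Qed.

Lemma mon_basis4 b : x1 ^+ (m - 1) * y1 ^+ (m - 1 - b) * y2 ^+ b =
  mon (m - 1) (m - 1 - b) 0 b.
Proof. by rewrite /mon expr0 mulr1. Qed.

Lemma mon_basis4' b : x2 ^+ (m - 1) * y1 ^+ (m - b) * y2 ^+ (b - 1) =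
  mon 0 (m - b) (m - 1) (b - 1).
Proof. by rewrite /mon expr0 mul1r (mulrC (x2 ^+ _)). Qed.

Lemma HP0_span_mon i j k l : wt i j k l \in S.
Proof.
apply: (weight_span hm wt_euler wt_shift wt_x wt_y) => [a b am bm|a am|a b b1 ab|b bm].
- rewrite /wt -mon_basis1; apply: basis_in; rewrite !mem_cat; apply/orP; left.
  by apply: allpairs_f; rewrite mem_index_iota.
- rewrite /wt -HP0_piD -!mon_basis1; apply: basis_in; rewrite !mem_cat.
  apply/orP; right; apply/orP; left.
  by apply: (map_f (fun a => x1 ^+ (m - 1) * x2 ^+ a * y1 ^+ (m - 1) * y2 ^+ a
       + x1 ^+ a * x2 ^+ (m - 1) * y1 ^+ a * y2 ^+ (m - 1))); rewrite mem_index_iota.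
- rewrite /wt -mon_basis3 -mon_basis3'; split; apply: basis_in; rewrite !mem_cat.
    apply/orP; right; apply/orP; right; apply/orP; left; apply/orP; left.
    by apply/allpairsPdep; exists a, b; rewrite !mem_index_iota; split=> //; lia.
  apply/orP; right; apply/orP; right; apply/orP; left; apply/orP; right.
  by apply/allpairsPdep; exists a, b; rewrite !mem_index_iota; split=> //; lia.
- rewrite /wt -!HP0_piZ -HP0_piB -mon_basis4 -mon_basis4'; apply: basis_in.
  rewrite !mem_cat; apply/orP; right; apply/orP; right; apply/orP; right.
  by apply: (map_f (fun b => b%:R *: (x1 ^+ (m - 1) * y1 ^+ (m - 1 - b) * y2 ^+ b)
       - (m - b)%:R *: (x2 ^+ (m - 1) * y1 ^+ (m - b) * y2 ^+ (b - 1))));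
    rewrite mem_index_iota.
Qed.

Lemma HP0_span f : exists c : nat -> K,
  f - \sum_(i < size L) c i *: L`_i \in HP_brackets G.
Proof.
have /linspan_seq[c fc] : HP0_pi G f \in S.
  elim/mpoly_linear_ind: f => [k|a f g fS gS].
    by rewrite mpolyX_mon; exact: HP0_span_mon.
  by rewrite linearP rpredD ?rpredZ.
exists c; apply/quot_piP; rewrite -[LHS]/(HP0_pi G f) fc size_map linear_sum.
by apply: eq_bigr => i _; rewrite (nth_map 0) // linearZ.
Qed.

Lemma basis_homog p : p \in L -> exists d, p \is d.-homog.
Proof.
rewrite !mem_cat => /or4P[/allpairsP[[a b] /= [_ _ ->]]|/mapP[a _ ->]|/orP[]|/mapP[b]].
- by eexists; rewrite mon_basis1; exact: mon_homog.
- exists ((m - 1) + (m - 1) + a + a)%N; rewrite !mon_basis1 rpredD ?mon_homog //.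
  by rewrite (_ : m - 1 + (m - 1) + a + a = a + a + (m - 1) + (m - 1))%N ?mon_homog //; lia.
- by move=> /allpairsPdep[a [b [_ _ ->]]]; eexists; rewrite mon_basis3; exact: mon_homog.
- by move=> /allpairsPdep[a [b [_ _ ->]]]; eexists; rewrite mon_basis3'; exact: mon_homog.
- rewrite mem_index_iota => bm ->; rewrite mon_basis4 mon_basis4'.
  exists ((m - 1) + (m - 1 - b) + 0 + b)%N; rewrite rpredB ?rpredZ ?mon_homog //.
  by rewrite (_ : m - 1 + (m - 1 - b) + 0 + b = 0 + (m - b) + (m - 1) + (b - 1))%N ?mon_homog //; lia.
Qed.

(** The four families have $(m-1)^2$, $m-1$, $(m-1)(m-2)$ and $m-1$ members. *)
Lemma size_basis : size L = ((m - 1) * (m - 1) + m * (m - 1))%N.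
Proof.
rewrite !size_cat size_allpairs !size_map !size_allpairs_dep !size_iota.
have H M : (sumn [seq size (index_iota 1 (M - a)) | a <- index_iota 0 M] * 2 = M * (M - 1))%N.
  have -> : sumn [seq size (index_iota 1 (M - a)) | a <- index_iota 0 M] =
      (\sum_(0 <= a < M) (M - 1 - a))%N.
    rewrite sumnE big_map; apply: eq_bigr => a _; rewrite size_iota; lia.
  rewrite big_mkord; elim: M => [|M IHM]; first by rewrite big_ord0.
  rewrite big_ord_recl.
  rewrite (eq_bigr (fun i : 'I_M => (M - 1 - i)%N)); last by move=> i _; rewrite /= /bump; lia.
  rewrite mulnDl IHM !subn1 subn0 /=; case: M {IHM} => [|M] //=; nia.
have := H (m - 1)%N; case: m hm => [|[|k]] // _.
  rewrite !subn1 /=; nia.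
Qed.

End Relations.

(** In characteristic 0 the polynomial $X^m-1$ is separable, so it has $m$ distinct roots, and such
    a set of roots contains a primitive one. *)
Lemma prim_root_exists (K : numClosedFieldType) (m : nat) : (0 < m)%N ->
  exists z : K, m.-primitive_root z.
Proof.
move=> m0; have [r Er] := closed_field_poly_normal ('X^m - 1 : {poly K}).
rewrite (monicP _) ?monicXnsubC // scale1r in Er.
have rm : all m.-unity_root r by apply/allP => z; rewrite -root_prod_XsubC -Er.
have mr : (m < (size r).+1)%N by rewrite -(size_prod_XsubC r id) -Er size_XnsubC.
have ur : uniq r.
  by rewrite -separable_prod_XsubC -Er separable_Xn_sub_1 // pnatr_eq0 -lt0n.
by have /hasP[z _ zm] := has_prim_root m0 rm ur mr; exists z.
Qed.

Lemma det2 (K : fieldType) (A : 'M[K]_2) : \det A = A 0 0 * A 1 1 - A 0 1 * A 1 0.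
Proof.
rewrite (expand_det_row _ 0) sum2 /cofactor !det_mx11 !mxE /= addn0 expr0 expr1.
have -> : lift 0 0 = 1 :> 'I_2 by apply/val_inj.
have -> : lift 1 0 = 0 :> 'I_2 by apply/val_inj.
by rewrite mul1r mulN1r mulrN.
Qed.

(** * Group elements without eigenvalue 1 *)

Section Elliptic.
Variables (K : numClosedFieldType) (m : nat) (z : K).
Hypothesis (hm : (2 <= m)%N) (zm : m.-primitive_root z).

(* The [(m - 1)^2 + m (m - 1)] elements of G(m,1,2) without eigenvalue 1. *)
Definition elliptic (t : 'I_(m - 1) * 'I_(m - 1) + 'I_m * 'I_(m - 1)) : 'M[K]_2 :=
  match t with
  | inl (i, j) => dmx (z ^+ i.+1) (z ^+ j.+1)
  | inr (i, j) => amx (z ^+ i) (z ^+ j.+1 / z ^+ i)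
  end.

Lemma prim_root_exp_order k : (z ^+ k) ^+ m = 1.
Proof. by rewrite exprAC (prim_expr_order zm) expr1n. Qed.

Lemma prim_root_neq0 k : z ^+ k != 0.
Proof. exact: (@root1_neq0 K m (ltnW hm) _ (prim_root_exp_order k)). Qed.

Lemma prim_root_neq1 (i : 'I_(m - 1)) : z ^+ i.+1 != 1.
Proof.
rewrite -(expr0 z) (eq_prim_root_expr zm) mod0n modn_small //.
by have := ltn_ord i; lia.
Qed.

Lemma prim_root_inj i j : (i < m)%N -> (j < m)%N -> z ^+ i = z ^+ j -> i = j.
Proof.
by move=> im jm /eqP; rewrite (eq_prim_root_expr zm) !modn_small // => /eqP.
Qed.

Lemma elliptic_G t : G_m1 K m 2 (elliptic t).
Proof.
have m0 : (0 < m)%N by lia.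
case: t => -[i j] /=; [apply: G_m1_dmx|apply: G_m1_amx] => //;
  by rewrite ?expr_div_n !prim_root_exp_order ?divr1.
Qed.

(** The determinant of $A-1$ is $(a-1)(b-1)$ in the diagonal case and $1-ab$ in the antidiagonal
    one; the second antidiagonal entry is chosen so that $ab=z^{j+1}$. *)
Lemma elliptic_unit t : elliptic t - 1%:M \in unitmx.
Proof.
rewrite unitmxE unitfE det2; case: t => -[i j] /=; rewrite !mxE /=.
  by rewrite !subr0 mulr0 subr0 mulf_neq0 // subr_eq0 prim_root_neq1.
rewrite !sub0r !subr0 mulrNN mulr1 mulrCA divff ?prim_root_neq0 // mulr1.
by rewrite subr_eq0 eq_sym prim_root_neq1.
Qed.

Lemma elliptic_inj : injective elliptic.
Proof.
have small (i : 'I_(m - 1)) : (i.+1 < m)%N by have := ltn_ord i; lia.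
case=> -[i j] [] [i' j'] /= /matrixP E.
- have := E 0 0; rewrite !mxE /= => /(prim_root_inj (small _) (small _)) [/ord_inj ->].
  by have := E 1 1; rewrite !mxE /= => /(prim_root_inj (small _) (small _)) [/ord_inj ->].
- by have := E 0 0; rewrite !mxE /= => /eqP; rewrite (negPf (prim_root_neq0 _)).
- by have := E 0 0; rewrite !mxE /= => /esym/eqP; rewrite (negPf (prim_root_neq0 _)).
- have := E 0 1; rewrite !mxE /= => zii; have := prim_root_inj (ltn_ord _) (ltn_ord _) zii.
  move=> /ord_inj ii; have := E 1 0; rewrite !mxE /= zii.
  move=> /(mulIf _) jj; move: jj; rewrite invr_eq0 prim_root_neq0 => /(_ isT).
  by move=> /(prim_root_inj (small _) (small _)) [/ord_inj ->]; rewrite ii.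
Qed.

Lemma card_elliptic :
  #|{: 'I_(m - 1) * 'I_(m - 1) + 'I_m * 'I_(m - 1)}| = ((m - 1) * (m - 1) + m * (m - 1))%N.
Proof. by rewrite card_sum !card_prod !card_ord. Qed.

End Elliptic.

Lemma HP0_G_m12 (K : numClosedFieldType) (m : nat) (G := G_m1 K m 2) : (2 <= m)%N ->
  HP0_iso_gr_HH0 G /\ is_basis [seq HP0_pi G p | p <- HP0_basis K m] /\
  forall p, p \in HP0_basis K m -> exists d, HP0_homog d (HP0_pi G p).
Proof.
move=> hm; have [z zm] := @prim_root_exists K m (ltnW hm).
have e : size (HP0_basis K m) = #|{: 'I_(m - 1) * 'I_(m - 1) + 'I_m * 'I_(m - 1)}|.
  by rewrite size_basis // card_elliptic.
pose A t := elliptic z (enum_val (cast_ord e t)).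
have [deg degP] : exists deg : nat -> nat, forall i,
    (HP0_basis K m)`_i \is (deg i).-homog.
  (* Past the end of the list the default entry is 0, which is homogeneous of every degree. *)
  have /choice[deg degP] i : exists d, (HP0_basis K m)`_i \is d.-homog.
    have [iL|Li] := ltnP i (size (HP0_basis K m)).
      by apply: (basis_homog hm); exact: mem_nth.
    by exists 0%N; rewrite nth_default // dhomog0.
  by exists deg.
have AM t : A t *m invmx (A t - 1%:M) = invmx (A t - 1%:M) + 1%:M.
  have := mulmxV (elliptic_unit hm zm (enum_val (cast_ord e t))).
  rewrite mulmxBl mul1mx => /eqP; rewrite subr_eq => /eqP ->; exact: addrC.
have M_inj : injective (fun t => invmx (A t - 1%:M)).
  move=> t t' /(can_inj (@invmxK _ _)) /addIr /(elliptic_inj hm zm) /enum_val_inj.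
  exact: cast_ord_inj.
have [iso basis] := HP0_iso_basis (@G_m1_unit K m) degP (HP0_span hm)
  (fun t => elliptic_G hm zm _) AM M_inj.
split=> //; split=> // p /(basis_homog hm)[d pd].
by exists d, p.
Qed.

Theorem theorem7p6 (R : realType) (m : nat) (hm : (2 <= m)%N) :
  let G := G_m1 R[i] m 2 in
  HP0_iso_gr_HH0 G /\
  is_basis [seq HP0_pi G p | p <- HP0_basis R[i] m] /\
  forall p : {mpoly R[i][2 + 2]}, p \in HP0_basis R[i] m ->
    exists d : nat, HP0_homog d (HP0_pi G p).
Proof. exact: HP0_G_m12. Qed.
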